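(* Let $\mathbb{k}$ be an infinite field, $R=\mathbb{k}[x_1,\dots,x_d]$ a polynomial ring, and $I$ a nonzero ideal generated by monomials $f_1,\dots,f_u$ of the same degree $\delta$. Let $\ell$ be the analytic spread of $I$, let $\underline z=\{z_{ij}\mid 1\leqslant i\leqslant\ell,\ 1\leqslant j\leqslant u\}$ be variables over $R$, and let $J$ be the ideal of $R[\underline z]$ generated by $b_i=\sum_{j=1}^u z_{ij}f_j$, $1\leqslant i\leqslant \ell$. Write $\operatorname{mono}(J)=C_1(\mathbf{x}^{\mathbf v_1})+\cdots+C_r(\mathbf{x}^{\mathbf v_r})$ with $\mathbf v_1,\dots,\mathbf v_r\in\mathbb{N}^d$ distinct and $C_1,\dots,C_r$ ideals of $\mathbb{k}[\underline z]$, and let $\mathcal{C}=C_1+\cdots+C_r$. If $\sqrt{C_i}=\mathcal{C}$ for every $i$, then $\operatorname{gradedcore}(I)=\operatorname{mono}(J_{\underline\lambda})$ for general $\underline\lambda\in\mathbb{A}^{\ell u}_{\mathbb{k}}$.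
   Context: The analytic spread $\ell$ of $I$ is the dimension of the special fiber ring $\bigoplus_{n\geqslant0}I^n/\mathfrak m I^n$, $\mathfrak m=(x_1,\dots,x_d)$. For $\mathbf v=(v_1,\dots,v_d)$, $\mathbf x^{\mathbf v}=x_1^{v_1}\cdots x_d^{v_d}$. For an ideal $L$ of $R[\underline z]=\mathbb{k}[\underline z][x_1,\dots,x_d]$, $\operatorname{mono}(L)$ is the ideal generated by all elements of $L$ of the form $a\,m$ with $a\in\mathbb{k}[\underline z]$ and $m$ a monomial in $x_1,\dots,x_d$; for an ideal of $R$, $\operatorname{mono}$ is the largest monomial ideal contained in it. For $\underline\lambda=(\lambda_{ij})\in\mathbb{A}^{\ell u}_{\mathbb{k}}$, $J_{\underline\lambda}\subseteq R$ is the ideal generated by $\sum_{j=1}^u\lambda_{ij}f_j$, $1\leqslant i\leqslant\ell$. ''For general $\underline\lambda$'' means for all $\underline\lambda$ in some Zariski dense open subset of $\mathbb{A}^{\ell u}_{\mathbb{k}}$. A subideal $J'\subseteq I$ is a reduction of $I$ if $I^{m+1}=J'I^m$ for $m\gg0$; $\operatorname{gradedcore}(I)$ is the intersection of all homogeneous reductions of $I$. *)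

(* Defs.v *)
From HB Require Import structures.
From mathcomp Require Import all_boot all_order all_algebra.
From mathcomp Require Import boolp classical_sets cardinality.
From mathcomp Require Import mpoly.

Set Implicit Arguments.
Unset Strict Implicit.
Unset Printing Implicit Defensive.

Import GRing.Theory.

Local Open Scope classical_set_scope.
Local Open Scope ring_scope.

Section Ideals.
Variable A : comNzRingType.
Implicit Types (S K L : set A).

Definition is_ideal K : Prop :=
  [/\ K 0, forall a b, K a -> K b -> K (a + b) & forall r a, K a -> K (r * a)].

Definition ideal_gen S : set A := smallest is_ideal S.

Definition ideal_sum (T : Type) (C : T -> set A) : set A :=
  ideal_gen (\bigcup_t C t).

Definition ideal_mul K L : set A := ideal_gen [set a * b | a in K & b in L].

Definition ideal_pow K (n : nat) : set A := iter n (ideal_mul K) setT.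

Definition radical K : set A := [set a | exists n : nat, K (a ^+ n)].

Definition is_reduction K L : Prop :=
  [/\ is_ideal L, L `<=` K &
      exists N : nat, forall m : nat, (N <= m)%N ->
        ideal_pow K m.+1 = ideal_mul L (ideal_pow K m)].

Lemma ideal_gen_ideal S : is_ideal (ideal_gen S).
Proof.
split=> [K [[]] //|a b aS bS K KS|r a aS K KS]; case: (KS) => [[_ KD KM] _].
- by apply: KD; [exact: aS|exact: bS].
- by apply: KM; exact: aS.
Qed.

Lemma sub_ideal_gen S : S `<=` ideal_gen S.
Proof. by move=> a Sa K [_]; apply. Qed.

Lemma ideal_gen_min S K : is_ideal K -> S `<=` K -> ideal_gen S `<=` K.
Proof. by move=> idK SK a; apply. Qed.

Lemma ideal_gen_mono S T : S `<=` T -> ideal_gen S `<=` ideal_gen T.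
Proof.
move=> ST; apply: ideal_gen_min; first exact: ideal_gen_ideal.
exact: subset_trans ST (@sub_ideal_gen T).
Qed.

Lemma idealN K a : is_ideal K -> K a -> K (- a).
Proof. by case=> _ _ KM Ka; rewrite -mulN1r; apply: KM. Qed.

Lemma idealB K a b : is_ideal K -> K a -> K b -> K (a - b).
Proof. by move=> idK Ka Kb; case: (idK) => _ KD _; apply: KD (idealN idK Kb). Qed.

Lemma ideal_sum_mem K (I : Type) (r : seq I) (P : pred I) (F : I -> A) :
  is_ideal K -> (forall i, P i -> K (F i)) -> K (\sum_(i <- r | P i) F i).
Proof. by case=> K0 KD _ KF; elim/big_ind: _. Qed.

Lemma ideal_pow_ideal K n : is_ideal (ideal_pow K n).
Proof. by case: n => [|n]; [split | apply: ideal_gen_ideal]. Qed.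

Lemma ideal_powM K m n a b :
  ideal_pow K m a -> ideal_pow K n b -> ideal_pow K (m + n) (a * b).
Proof.
elim: m a => [|m IHm] a Ka Kb.
  by rewrite add0n; case: (ideal_pow_ideal K n) => _ _; apply.
have [P0 PD PM] := ideal_pow_ideal K (m.+1 + n).
apply: (Ka [set c | ideal_pow K (m.+1 + n) (c * b)]); split.
  split=> /=; first by rewrite mul0r.
  - by move=> x y Kx Ky; rewrite mulrDl; apply: PD.
  - by move=> r x Kx; rewrite -mulrA; apply: PM.
move=> _ [x Kx] [y Ky] <-; rewrite /mkset -mulrA.
by apply: sub_ideal_gen; exists x => //; exists (y * b) => //; apply: IHm.
Qed.

End Ideals.

(* The Rees algebra A[Kt], inside A[t]: t^n carries coefficients in K^n. *)
Section Rees.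
Variables (A : comNzRingType) (K : set A).

Definition rees_pred : {pred {poly A}} :=
  fun p => `[< forall n, ideal_pow K n p`_n >].

Lemma rees_subring : subring_closed rees_pred.
Proof.
split=> [|p q /asboolP pR /asboolP qR|p q /asboolP pR /asboolP qR];
  apply/asboolP => n.
- by rewrite coef1; case: n => [|n] //; case: (ideal_pow_ideal K n.+1).
- by rewrite coefB; apply: idealB => //; apply: ideal_pow_ideal.
- rewrite coefM; apply: ideal_sum_mem; first exact: ideal_pow_ideal.
  by move=> i _; have := ideal_powM (pR i) (qR (n - i)%N);
    rewrite subnKC // -ltnS.
Qed.

HB.instance Definition _ := GRing.isSubringClosed.Build _ rees_pred rees_subring.

Record rees := Rees { rees_val :> {poly A}; _ : rees_val \in rees_pred }.

HB.instance Definition _ := [isSub for rees_val].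
HB.instance Definition _ := [Choice of rees by <:].
HB.instance Definition _ := [SubChoice_isSubComNzRing of rees by <:].

End Rees.

Section SpecialFiber.
Variables (k : fieldType) (d : nat) (I : set {mpoly k[d]}).

Definition irrelevant_ideal : set {mpoly k[d]} :=
  ideal_gen (range (fun i : 'I_d => 'X_i)).

(* The ideal \bigoplus_n m I^n of the Rees algebra \bigoplus_n I^n. *)
Definition fiber_ideal : {pred rees I} :=
  fun p => `[< forall n, ideal_mul irrelevant_ideal (ideal_pow I n)
                           (rees_val p)`_n >].

Lemma irrelevant_coef0 (p : {mpoly k[d]}) :
  ideal_mul irrelevant_ideal setT p -> p@_0%MM = 0.
Proof.
have id0 : is_ideal [set q : {mpoly k[d]} | q@_0%MM = 0].
  split=> /= [|a b a0 b0|r a a0]; first exact: mcoeff0.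
  - by rewrite mcoeffD a0 b0 addr0.
  - by rewrite rmorphM /= a0 mulr0.
apply: (ideal_gen_min id0) => _ [a am] [b _] <- /=; rewrite rmorphM /=.
suff -> : a@_0%MM = 0 by rewrite mul0r.
apply: (ideal_gen_min id0 _ am) => _ [i _ <-] /=.
by rewrite mcoeffX mnm1_eq0.
Qed.

Lemma fiber_ideal_closed : idealr_closed fiber_ideal.
Proof.
split.
- by apply/asboolP => n; rewrite coef0;
    case: (ideal_gen_ideal [set a * b | a in irrelevant_ideal & b in ideal_pow I n]).
- apply/negP => /asboolP /(_ 0%N) /irrelevant_coef0.
  by rewrite coef1 mcoeff1 eqxx => /eqP; rewrite oner_eq0.
- move=> a p q /asboolP pF /asboolP qF; apply/asboolP => n.
  have aR : forall j, ideal_pow I j (rees_val a)`_j by case: a => a /= /asboolP.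
  set M := ideal_mul irrelevant_ideal (ideal_pow I n).
  have idM : is_ideal M by exact: ideal_gen_ideal.
  have [M0 MD MM] := idM.
  rewrite -[rees_val _]/(rees_val a * rees_val p + rees_val q) coefD.
  apply: (MD); last exact: qF.
  rewrite coefM; apply: ideal_sum_mem => // i _.
  suff : ideal_mul irrelevant_ideal (ideal_pow I (n - i)) `<=`
         [set c | M ((rees_val a)`_i * c)] by apply; exact: pF.
  apply: ideal_gen_min.
    split=> /= [|x y Mx My|r x Mx]; first by rewrite mulr0.
    - by rewrite mulrDr; apply: MD.
    - by rewrite mulrCA; apply: MM.
  move=> _ [x xm] [y yI] <- /=; rewrite mulrCA; apply: sub_ideal_gen.
  exists x => //; exists ((rees_val a)`_i * y) => //.
  by have := ideal_powM (aR i) yI; rewrite subnKC // -ltnS.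
Qed.

HB.instance Definition _ := isIdealr.Build _ fiber_ideal fiber_ideal_closed.

Definition special_fiber := {ideal_quot fiber_ideal}.

End SpecialFiber.

(* A chain P_0 < ... < P_n of prime ideals has length n. *)
Definition prime_chain (A : comNzRingType) (n : nat) : Prop :=
  exists P : 'I_n.+1 -> prime_idealr A,
    forall i j : 'I_n.+1, (i < j)%N ->
      {subset P i <= P j} /\ ~ {subset P j <= P i}.

Definition is_krull_dim (A : comNzRingType) (n : nat) : Prop :=
  prime_chain A n /\ forall m, prime_chain A m -> (m <= n)%N.

Definition is_analytic_spread (k : fieldType) (d : nat)
    (I : set {mpoly k[d]}) (l : nat) : Prop :=
  is_krull_dim (special_fiber I) l.

Section MonomialParts.
Variable d : nat.

Definition monomial_ideal (A : comNzRingType) (K : set {mpoly A[d]}) : Prop :=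
  exists S : set 'X_{1..d}, K = ideal_gen [set 'X_[m] | m in S].

(* The sum of all monomial ideals contained in L; see [mono_largest]. *)
Definition mono (k : fieldType) (L : set {mpoly k[d]}) : set {mpoly k[d]} :=
  ideal_gen (\bigcup_(M in [set M | monomial_ideal M /\ M `<=` L]) M).

Lemma mono_largest (k : fieldType) (L : set {mpoly k[d]}) : is_ideal L ->
  [/\ monomial_ideal (mono L), mono L `<=` L &
      forall M, monomial_ideal M -> M `<=` L -> M `<=` mono L].
Proof.
move=> idL; split.
- exists [set m | L 'X_[m]]; apply/seteqP; split.
    apply: ideal_gen_min; first exact: ideal_gen_ideal.
    move=> p [M [[S MS] SL] Mp]; move: Mp SL; rewrite {}MS => Mp SL.
    move: p Mp; apply: ideal_gen_mono => _ [m Sm <-].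
    by exists m => //=; apply: SL; apply: sub_ideal_gen; exists m.
  apply: ideal_gen_mono => _ [m Lm <-].
  exists (ideal_gen [set 'X_[m'] | m' in [set m]]); last first.
    by apply: sub_ideal_gen; exists m.
  split; first by exists [set m].
  by apply: ideal_gen_min => // _ [_ -> <-].
- by apply: ideal_gen_min => // p [M [_ ML]]; apply: ML.
- by move=> M mM ML p Mp; apply: sub_ideal_gen; exists M.
Qed.

Variables (k : fieldType) (n : nat).

(* mono for ideals of k[z_1..z_n][x_1..x_d]. *)
Definition mono_param (L : set {mpoly {mpoly k[n]}[d]}) :
    set {mpoly {mpoly k[n]}[d]} :=
  ideal_gen (L `&` [set p | exists (a : {mpoly k[n]}) (m : 'X_{1..d}),
                              p = a *: 'X_[m]]).

(* The ideal C(x^v) of k[z_1..z_n][x_1..x_d]. *)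
Definition coef_monomial_ideal (C : set {mpoly k[n]}) (v : 'X_{1..d}) :
    set {mpoly {mpoly k[n]}[d]} :=
  ideal_gen [set c *: 'X_[v] | c in C].

End MonomialParts.

Section GradedCore.
Variables (k : fieldType) (d : nat).

Definition homogeneous_ideal (K : set {mpoly k[d]}) : Prop :=
  exists S : set {mpoly k[d]},
    (forall p, S p -> exists e : nat, p \is e.-homog) /\ K = ideal_gen S.

Definition graded_core (I : set {mpoly k[d]}) : set {mpoly k[d]} :=
  \bigcap_(L in [set L | is_reduction I L /\ homogeneous_ideal L]) L.

End GradedCore.

(* Points of the affine space with coordinates z_ij are l x u matrices over k;
   z_ij is the variable of {mpoly k[l * u]} of index [mxvec_index i j]. *)
Section General.
Variables (k : fieldType) (l u : nat).

Definition eval_at (la : 'M[k]_(l, u)) (g : {mpoly k[l * u]}) : k :=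
  g.@[fun h => mxvec la 0 h].

Definition zariski_open (U : set 'M[k]_(l, u)) : Prop :=
  exists S : set {mpoly k[l * u]},
    U = [set la | exists2 g, S g & eval_at la g != 0].

Definition zariski_dense (U : set 'M[k]_(l, u)) : Prop :=
  forall V, zariski_open V -> V !=set0 -> U `&` V !=set0.

Definition for_general (Q : set 'M[k]_(l, u)) : Prop :=
  exists U, [/\ zariski_open U, zariski_dense U & U `<=` Q].

End General.

Section LinearCombinations.
Variables (k : fieldType) (d u : nat) (f : 'I_u -> 'X_{1..d}).

Definition generated_by_monomials : set {mpoly k[d]} :=
  ideal_gen (range (fun j : 'I_u => 'X_[k, f j])).

Definition generic_ideal (l : nat) : set {mpoly {mpoly k[l * u]}[d]} :=
  ideal_gen (range (fun i : 'I_l =>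
    \sum_(j < u) 'X_(mxvec_index i j) *: 'X_[{mpoly k[l * u]}, f j])).

Definition specialized_ideal (l : nat) (la : 'M[k]_(l, u)) : set {mpoly k[d]} :=
  ideal_gen (range (fun i : 'I_l => \sum_(j < u) la i j *: 'X_[k, f j])).

End LinearCombinations.

Arguments generated_by_monomials k {d u} f.
Arguments generic_ideal k {d u} f l.
Arguments fiber_ideal {k d} I _.
Arguments special_fiber {k d} I.

(* Main.v *)
Require Import Defs.
From HB Require Import structures.
From mathcomp Require Import all_boot all_order all_algebra.
From mathcomp Require Import boolp classical_sets cardinality.
From mathcomp Require Import mpoly.

Set Implicit Arguments.
Unset Strict Implicit.
Unset Printing Implicit Defensive.

Import Order.TTheory GRing.Theory.

Local Open Scope classical_set_scope.
Local Open Scope ring_scope.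

(** The proof rests on three facts about the ideals J_la.

    (1) Every homogeneous reduction of I contains some J_la that is itself a
    reduction.  The forms of degree delta of a homogeneous reduction generate a
    reduction; as long as there are more than l generators they satisfy a
    homogeneous algebraic relation, since otherwise the special fiber ring would
    be integral over a polynomial ring in more than l variables and going-up
    would give too long a chain of primes.  Over an infinite field such a
    relation lets one drop a generator.  Hence gradedcore(I) is the intersection
    of the J_la that are reductions; this intersection is stable under the
    torus, so it is a monomial ideal.

    (2) If J_la is a reduction, a determinant g in k[z] with g(la) <> 0
    multiplies a power of I into J.  So g lies in the ideal C_1 + ... + C_r,
    some power of g lies in each C_i, and J_la contains all x^(v_i).  The same g
    shows that being a reduction is an open condition.

    (3) For general la, no monomial outside (x^(v_1), ..., x^(v_r)) lies in
    J_la.  Cutting off exponents at D >= max |v_i| reduces this to finitely many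
    assertions "x^c x_S^n is not in J_la for any n"; each holds generically
    because colon ideals commute with general specialization, which follows from
    division by a finite Groebner basis over the fraction field of k[z]. *)

(** * Ideals, homogeneous components and Dickson's lemma *)

Section IdealFacts.
Variable A : comNzRingType.
Implicit Types (S T K L : set A).

Lemma ideal_gen_imageP (T : finType) (g : T -> A) p :
  ideal_gen (range g) p <-> exists c : T -> A, p = \sum_t c t * g t.
Proof.
split=> [|[c ->]]; last first.
  apply: ideal_sum_mem; first exact: ideal_gen_ideal.
  move=> t _; have [_ _ KM] := ideal_gen_ideal (range g).
  by apply: KM; apply: sub_ideal_gen; exists t.
apply: (@ideal_gen_min _ _ [set p | exists c : T -> A, p = \sum_t c t * g t]).
  split=> [|a b [c ->] [e ->]|r a [c ->]].
  - by exists (fun=> 0); rewrite big1 // => t _; rewrite mul0r.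
  - exists (fun t => c t + e t).
    by rewrite -big_split; apply: eq_bigr => t _; rewrite mulrDl.
  - exists (fun t => r * c t).
    by rewrite mulr_sumr; apply: eq_bigr => t _; rewrite mulrA.
move=> _ [t _ <-]; exists (fun s => (s == t)%:R).
rewrite (bigD1 t) //= eqxx mul1r big1 ?addr0 // => s /negPf ->.
by rewrite mul0r.
Qed.

Lemma ideal_mul_gen S T :
  ideal_mul (ideal_gen S) (ideal_gen T) = ideal_gen [set a * b | a in S & b in T].
Proof.
set P := ideal_gen [set a * b | a in S & b in T].
have idP : is_ideal P by exact: ideal_gen_ideal.
have [P0 PD PM] := idP.
apply/seteqP; split; last first.
  apply: ideal_gen_mono => _ [a Sa [b Tb <-]].
  by exists a; [exact: sub_ideal_gen | exists b => //; exact: sub_ideal_gen].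
apply: ideal_gen_min => // _ [a Sa [b Tb <-]].
apply: (ideal_gen_min _ _ Sa (K := [set a | P (a * b)])).
  split=> /= [|x y Px Py|r x Px]; first by rewrite mul0r.
  - by rewrite mulrDl; apply: PD.
  - by rewrite -mulrA; apply: PM.
move=> {Sa}a Sa /=.
apply: (ideal_gen_min _ _ Tb (K := [set b | P (a * b)])).
  split=> /= [|x y Px Py|r x Px]; first by rewrite mulr0.
  - by rewrite mulrDr; apply: PD.
  - by rewrite mulrCA; apply: PM.
by move=> {Tb}b Tb /=; apply: sub_ideal_gen; exists a => //; exists b.
Qed.

Lemma ideal_mulr S : ideal_mul (ideal_gen S) setT = ideal_gen S.
Proof.
apply/seteqP; split.
  apply: ideal_gen_min; first exact: ideal_gen_ideal.
  move=> _ [a Sa [b _ <-]]; rewrite mulrC.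
  by case: (ideal_gen_ideal S) => _ _; apply.
move=> a Sa; apply: sub_ideal_gen; exists a => //; exists 1 => //.
exact: mulr1.
Qed.

(** Cramer's rule: combining the given elements with the adjugate of [M] recovers [\det M * e i]. *)
Lemma adjugate_ideal (n : nat) (K : set A) (M : 'M[A]_n) (e : 'I_n -> A) :
  is_ideal K -> (forall i, K (\sum_j M i j * e j)) ->
  forall i, K (\det M * e i).
Proof.
move=> idK MeK i; have [_ _ KM] := idK.
have -> : \det M * e i = \sum_j (\adj M *m M) i j * e j.
  rewrite mul_adj_mx (bigD1 i) //= mxE eqxx big1 ?addr0 ?mulr1n // => j.
  by rewrite mxE eq_sym => /negPf ->; rewrite mulr0n mul0r.
under eq_bigr => j _ do rewrite mxE mulr_suml.
rewrite exchange_big /=; apply: ideal_sum_mem => // j _.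
under eq_bigr => m _ do rewrite -mulrA.
by rewrite -mulr_sumr; apply: KM.
Qed.

End IdealFacts.

Lemma ideal_gen_morph (A B : comNzRingType) (phi : {rmorphism A -> B})
    (S : set A) (L : set B) :
  is_ideal L -> (forall a, S a -> L (phi a)) ->
  forall a, ideal_gen S a -> L (phi a).
Proof.
move=> [L0 LD LM] SL a Sa; apply: (ideal_gen_min _ _ Sa (K := phi @^-1` L)) => //.
split=> /= [|x y Lx Ly|r x Lx]; first by rewrite /= rmorph0.
- by rewrite /preimage /= rmorphD; apply: LD.
- by rewrite /preimage /= rmorphM; apply: LM.
Qed.

Lemma image_ideal (A B : comNzRingType) (phi : {rmorphism A -> B}) (L : set A) :
  is_ideal L -> (forall b, exists a, phi a = b) -> is_ideal (phi @` L).
Proof.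
move=> [L0 LD LM] phi_surj; split; first by exists 0 => //; rewrite rmorph0.
- by move=> _ _ [a La <-] [b Lb <-]; exists (a + b); [exact: LD|rewrite rmorphD].
- move=> r _ [a La <-]; have [s <-] := phi_surj r.
  by exists (s * a); [exact: LM|rewrite rmorphM].
Qed.

Section Homogeneous.
Variables (n : nat) (A : comNzRingType).
Implicit Types p q : {mpoly A[n]}.

Lemma pihomogM d e p q : q \is e.-homog ->
  pihomog mdeg (d + e) (p * q) = pihomog mdeg d p * q.
Proof.
move=> hq; rewrite [p in LHS]mpolyE [p in RHS]mpolyE.
rewrite mulr_suml !linear_sum /= mulr_suml; apply: eq_bigr => m _.
rewrite -scalerAl !linearZ /= -scalerAl; congr (_ *: _).
have hXq : 'X_[m] * q \is (mdeg m + e).-homog.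
  by apply: dhomogM => //; rewrite dhomogX.
rewrite pihomogX; case: eqP => [<-|/eqP ne]; first by rewrite pihomog_dE.
by rewrite (pihomog_ne0 _ hXq) ?mul0r // eqn_add2r.
Qed.

Lemma pihomogM_lt d e p q : q \is e.-homog -> (d < e)%N ->
  pihomog mdeg d (p * q) = 0.
Proof.
move=> hq lt_de; rewrite [p]mpolyE mulr_suml linear_sum big1 // => m _.
rewrite -scalerAl linearZ /=; have hXq : 'X_[m] * q \is (mdeg m + e).-homog.
  by apply: dhomogM => //; rewrite dhomogX.
rewrite (pihomog_ne0 _ hXq) ?scaler0 // gtn_eqF //.
exact: leq_trans lt_de (leq_addl _ _).
Qed.

Lemma pihomog0E p : pihomog mdeg 0 p = (p@_0%MM)%:MP.
Proof.
rewrite [p in LHS]mpolyE linear_sum /=.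
have [p0|p0] := boolP (0%MM \in msupp p).
  rewrite (bigD1_seq 0%MM) //= linearZ /= pihomogX /= mdeg0 eqxx big1.
    by rewrite addr0 mpolyX0 alg_mpolyC.
  by move=> m nz_m; rewrite linearZ /= pihomogX /= mdeg_eq0 (negPf nz_m) scaler0.
rewrite (memN_msupp_eq0 p0) mpolyC0 big1_seq // => m /= m_p.
rewrite linearZ /= pihomogX /= mdeg_eq0; case: eqP => [m0|]; last by rewrite scaler0.
by rewrite m0 (negPf p0) in m_p.
Qed.

Lemma pihomog_ideal (S : set {mpoly A[n]}) :
  (forall p, S p -> exists e, p \is e.-homog) ->
  forall d p, ideal_gen S p -> ideal_gen S (pihomog mdeg d p).
Proof.
move=> homS d p; have [S0 SD SM] := ideal_gen_ideal S => Sp; move: p Sp d.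
(* The multiplier [r] makes [K] an ideal, so that only generators remain to be checked. *)
pose K : set {mpoly A[n]} := [set p | forall r d, ideal_gen S (pihomog mdeg d (r * p))].
suff SK : ideal_gen S `<=` K by move=> p /SK /(_ 1); rewrite mul1r.
apply: ideal_gen_min.
  rewrite /K; split=> /=.
  - by move=> r d; rewrite mulr0 linear0.
  - by move=> a b Ka Kb r d; rewrite mulrDr linearD; apply: SD; [apply: Ka|apply: Kb].
  - by move=> r a Ka s d; rewrite mulrA; apply: Ka.
move=> p Sp r d; have [e he] := homS _ Sp.
have [le_ed|lt_de] := leqP e d; last by rewrite (pihomogM_lt _ he).
by rewrite -(subnK le_ed) (pihomogM _ _ he); apply: SM; apply: sub_ideal_gen.
Qed.

End Homogeneous.

Section Dickson.

Lemma nondecreasing_subsequence (s : nat -> nat) :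
  exists phi : nat -> nat, (forall n, (phi n < phi n.+1)%N) /\
    (forall n, (s (phi n) <= s (phi n.+1))%N).
Proof.
(* Each tail of [s] attains a minimum; minima of successive tails give the subsequence. *)
have tail_min N : exists i, (N <= i)%N /\ forall j, (N <= j)%N -> (s i <= s j)%N.
  pose P m := `[< exists2 i, (N <= i)%N & s i = m >].
  have exP : exists m, P m by exists (s N); apply/asboolP; exists N.
  case: (ex_minnP exP) => m /asboolP[i leNi <-] mmin.
  by exists i; split=> // j leNj; apply: mmin; apply/asboolP; exists j.
have [g gP] := choice tail_min.
pose phi := fix phi n := if n is m.+1 then g (phi m).+1 else g 0%N.
have leS n : (phi n < phi n.+1)%N by exact: (gP (phi n).+1).1.
exists phi; split=> // -[|n]; first by apply: (gP 0%N).2.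
by apply: (gP (phi n).+1).2; exact: leq_trans (leS n) (ltnW (leS _)).
Qed.

Lemma increasing_le (phi : nat -> nat) : (forall n, (phi n < phi n.+1)%N) ->
  {homo phi : m n / (m <= n)%N}.
Proof.
move=> phiS m n /subnKC <-; elim: (n - m)%N => [|k IHk]; first by rewrite addn0.
by rewrite addnS; apply: leq_trans IHk (ltnW (phiS _)).
Qed.

Lemma mnm_good_pair d (s : nat -> 'X_{1..d}) :
  exists i j, (i < j)%N /\ (s i <= s j)%MM.
Proof.
(* Refinement one coordinate at a time: a further subsequence stays monotone in the coordinates
   already treated. *)
have sub (r : seq 'I_d) : exists phi : nat -> nat,
    (forall n, (phi n < phi n.+1)%N) /\
    (forall x, x \in r -> {homo (fun n => s (phi n) x) : m n / (m <= n)%N}).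
  elim: r => [|x r [phi [phiS phir]]]; first by exists id.
  have [psi [psiS psix]] := nondecreasing_subsequence (fun n => s (phi n) x).
  have phi_lt m n : (m < n)%N -> (phi m < phi n)%N.
    by move=> lt_mn; apply: leq_trans (phiS m) (increasing_le phiS lt_mn).
  exists (phi \o psi); split=> [n|y]; first exact/phi_lt/psiS.
  rewrite inE => /predU1P[->|yr] m n le_mn /=; last first.
    exact/(phir y yr)/increasing_le.
  rewrite -(subnKC le_mn); elim: (n - m)%N => [|e IHe]; first by rewrite addn0.
  by rewrite addnS; apply: leq_trans IHe (psix _).
have [phi [phiS phiP]] := sub (enum 'I_d).
exists (phi 0%N), (phi 1%N); split=> //; apply/mnm_lepP => x.
by apply: (phiP x _ 0%N 1%N) => //; rewrite mem_enum.
Qed.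

(** Without a finite [B] one could go on choosing elements of [S] divisible by no earlier one,
    against [mnm_good_pair]. *)
Lemma dickson d (S : set 'X_{1..d}) : exists B : seq 'X_{1..d},
  (forall b, b \in B -> S b) /\
  (forall m, S m -> exists2 b, b \in B & (b <= m)%MM).
Proof.
apply: contrapT => noB.
have ext (B : seq 'X_{1..d}) : exists m, (forall b, b \in B -> S b) ->
    S m /\ forall b, b \in B -> ~~ (b <= m)%MM.
  have [BS|BS] := pselect (forall b, b \in B -> S b); last by exists 0%MM => /BS.
  apply: contrapT => nom; apply: noB; exists B; split=> // m Sm.
  apply: contrapT => nob; apply: nom; exists m => _; split=> // b Bb.
  by apply/negP => le_bm; apply: nob; exists b.
have [h hP] := choice ext.
pose B := fix B n := if n is m.+1 then h (B m) :: B m else [::].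
have BS n b : b \in B n -> S b.
  elim: n b => [|n IHn] b //=; rewrite inE => /predU1P[->|/IHn //].
  by have [] := hP _ IHn.
have [i [j [lt_ij le_ij]]] := mnm_good_pair (fun n => h (B n)).
have : h (B i) \in B j.
  rewrite -(subnKC lt_ij); elim: (j - i.+1)%N => [|e IHe].
    by rewrite addn0 /= inE eqxx.
  by rewrite addnS /= inE IHe orbT.
by move=> /((hP _ (BS j)).2); rewrite le_ij.
Qed.

End Dickson.

Lemma ideal_gen_mull (A : comNzRingType) (S K : set A) q p :
  is_ideal K -> (forall s, S s -> K (q * s)) -> ideal_gen S p -> K (q * p).
Proof.
move=> [K0 KD KM] SK Sp; apply: (ideal_gen_min _ _ Sp (K := [set p | K (q * p)])).
  split=> /= [|x y Kx Ky|r x Kx]; first by rewrite mulr0.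
  - by rewrite mulrDr; apply: KD.
  - by rewrite mulrCA; apply: KM.
by move=> s Ss; apply: SK.
Qed.

Lemma ideal_scale (A : comNzRingType) n (L : set {mpoly A[n]}) c p :
  is_ideal L -> L p -> L (c *: p).
Proof. by move=> [_ _ LM] Lp; rewrite -mul_mpolyC; apply: LM. Qed.

(** * Generic division and colon ideals *)

Section GenericDivision.
Variables (A : idomainType) (d : nat).
Implicit Types (L : set {mpoly A[d]}) (p q r : {mpoly A[d]}).

(** The shape of remainders in division by [L]. Leading coefficients are ignored, as over the
    fraction field. *)
Definition standard L p : Prop :=
  forall m, m \in msupp p -> forall q, L q -> q != 0 -> ~~ (mlead q <= m)%MM.

Lemma standard_eq0 L p : L p -> standard L p -> p = 0.
Proof.
move=> Lp stdp; apply/eqP; apply: contraT => nzp.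
by have := stdp _ (mlead_supp nzp) _ Lp nzp; rewrite lepm_refl.
Qed.

Lemma standardD L p q : standard L p -> standard L q -> standard L (p + q).
Proof.
move=> stdp stdq m /msuppD_le; rewrite mem_cat => /orP[]; [exact: stdp|exact: stdq].
Qed.

Lemma standardZ L c p : standard L p -> standard L (c *: p).
Proof. by move=> stdp m /msuppZ_le; apply: stdp. Qed.

(* [a] is the product of the leading coefficients of a finite Groebner basis
   of the extension of [L] to the fraction field of [A]. *)
Lemma generic_division L : is_ideal L -> exists2 a : A, a != 0 &
  forall p, exists n q r, [/\ a ^+ n *: p = q + r, L q & standard L r].
Proof.
move=> idL; have [L0 LD LM] := idL.
have [B [BL Bdiv]] := dickson [set m | exists2 p, L p & p != 0 /\ mlead p = m].
have [g gP] : exists g : 'X_{1..d} -> {mpoly A[d]},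
    forall b, b \in B -> [/\ L (g b), g b != 0 & mlead (g b) = b].
  suff /choice[g gP] : forall b, exists p : {mpoly A[d]},
      b \in B -> [/\ L p, p != 0 & mlead p = b] by exists g.
  move=> b; have [Bb|_] := boolP (b \in B); last by exists 0.
  by have [p Lp [nzp lp]] := BL b Bb; exists p.
pose a := \prod_(b <- undup B) mleadc (g b); exists a.
  rewrite prodf_seq_neq0; apply/allP => b; rewrite mem_undup => Bb /=.
  by have [_ nzg _] := gP b Bb; rewrite mleadc_eq0.
have lead_lt p m : (mlead p <= m)%O -> p@_m = 0 -> p != 0 -> (mlead p < m)%O.
  move=> le_pm pm0 nzp; rewrite lt_neqAle le_pm andbT.
  by apply: contraNneq nzp => lp; rewrite -mleadc_eq0 lp pm0.
elim/mleadrect => p IHp; set m := mlead p in IHp.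
have step p' : (mlead p' <= m)%O -> p'@_m = 0 ->
    exists n q r, [/\ a ^+ n *: p' = q + r, L q & standard L r].
  move=> le_p'm p'm0; have [->|nzp'] := eqVneq p' 0; last exact/IHp/lead_lt.
  by exists 0%N, 0, 0; split=> [||m'] //; rewrite ?scaler0 ?addr0 ?msupp0.
have [/hasP[b Bb le_bm]|/hasPn noB] := boolP (has (fun b => b <= m)%MM B).
  have [Lg nzg lg] := gP b Bb.
  have [a' aE] : exists a', a = mleadc (g b) * a'.
    rewrite /a (bigD1_seq b) ?mem_undup ?undup_uniq //=; by eexists.
  (* [t] has the coefficient of [a *: p] at [m] and no larger monomial, so the difference falls
     under [step]. *)
  pose t := (p@_m * a') *: (g b * 'X_[m - b]).
  have Lt : L t by apply: ideal_scale => //; rewrite mulrC; apply: LM.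
  have [||n [q [r [def_n Lq stdr]]]] := step (a *: p - t).
  - apply: le_trans (mleadB_le _ _) _; rewrite leUx (mleadZ_le a p) /=.
    apply: le_trans (mleadZ_le _ _) _; apply: le_trans (mleadM_le _ _) _.
    by rewrite lg mleadXm addmC submK.
  - rewrite mcoeffB !mcoeffZ -[X in (_ * 'X_[_])@_X](submK le_bm) mcoeffMX.
    by rewrite aE lg mulrC [_ * a']mulrC mulrA subrr.
  exists n.+1, (q + a ^+ n *: t), r; split=> //.
    rewrite -addrA [_ *: t + r]addrC addrA -def_n scalerBr scalerA -exprSr subrK.
    by [].
  by apply: LD => //; apply: ideal_scale.
(* No leading monomial of [L] divides [m], so the leading term of [p] moves to the remainder. *)
have [||n [q [r [def_n Lq stdr]]]] := step (p - p@_m *: 'X_[m]).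
- apply: le_trans (mleadB_le _ _) _; rewrite leUx lexx /=.
  by apply: le_trans (mleadZ_le _ _) _; rewrite mleadXm.
- by rewrite mcoeffB mcoeffZ mcoeffX eqxx mulr1 subrr.
exists n, q, (r + a ^+ n *: (p@_m *: 'X_[m])); split=> //.
  by rewrite addrA -def_n -scalerDr subrK.
apply: standardD => //; do 2 apply: standardZ; move=> m' /mem_msuppXP <- s Ls nzs.
apply/negP => le_sm; have [|b Bb le_bs] := Bdiv (mlead s); first by exists s.
by have := noB b Bb; rewrite (lepm_trans le_bs le_sm).
Qed.

(* Generic flatness of [A[x]/L]: taking [T] to be [(ker ev) L], this is the
   vanishing of Tor_1 of [A[x]/L] with the residue field of [ev]. *)
Lemma generic_flatness L : is_ideal L -> exists2 a : A, a != 0 &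
  forall (k : fieldType) (ev : {rmorphism A -> k}) (T : set {mpoly A[d]}),
    is_ideal T -> (forall c p, ev c = 0 -> L p -> T (c *: p)) ->
  forall p, L p -> map_mpoly ev p = 0 -> exists n, T (a ^+ n *: p).
Proof.
move=> idL; have [L0 LD LM] := idL; have [a nza adiv] := generic_division idL.
exists a => // k ev T idT TZ p Lp evp; have [T0 TD _] := idT.
(* It suffices to divide with quotient in [T]: the remainder is then standard and lies in [L], hence
   is zero. *)
suff [n [q [r [def_n Tq Lq stdr]]]] : exists n q r,
    [/\ a ^+ n *: p = q + r, T q, L q & standard L r].
  exists n; suff r0 : r = 0 by rewrite def_n r0 addr0.
  apply: (standard_eq0 (L := L)) => //.
  rewrite -[r](addKr q) -def_n addrC; apply: idealB => //.
  exact: ideal_scale.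
have pc m : ev p@_m = 0 by rewrite -mcoeff_map_mpoly evp mcoeff0.
(* [p] is divided monomial by monomial. Its coefficients lie in the kernel of [ev], so they carry
   the quotients, elements of [L], into [T]. *)
rewrite [p]mpolyE; elim: (msupp p) => [|m s [n [q [r [def_n Tq Lq stdr]]]]].
  exists 0%N, 0, 0; rewrite big_nil scaler0 addr0; split=> // m.
  by rewrite msupp0.
have [n' [q' [r' [def_n' Lq' stdr']]]] := adiv 'X_[m].
exists (n + n')%N, (a ^+ n' *: q + (a ^+ n * p@_m) *: q').
exists (a ^+ n' *: r + (a ^+ n * p@_m) *: r'); split.
- rewrite big_cons addrACA -!scalerDr -def_n -def_n' scalerDr addrC !scalerA.
  by rewrite exprD mulrAC [a ^+ n * a ^+ n']mulrC.
- apply: TD; first exact: ideal_scale.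
  by apply: TZ => //; rewrite rmorphM pc mulr0.
- by apply: LD; apply: ideal_scale.
- by apply: standardD; apply: standardZ.
Qed.

(* Generic flatness for [L + (b)] rewrites [b p - q], which vanishes under
   [ev], as an element of [(ker ev) L + (ker ev) b]. *)
Lemma generic_colon L b : is_ideal L -> exists2 a : A, a != 0 &
  forall (k : fieldType) (ev : {rmorphism A -> k}),
    (forall c, exists e, ev e = c) -> ev a != 0 ->
  forall p q, L q -> map_mpoly ev (b * p) = map_mpoly ev q ->
    exists2 p', L (p' * b) & map_mpoly ev p' = map_mpoly ev p.
Proof.
move=> idL; have [L0 LD LM] := idL.
pose Lb : set {mpoly A[d]} := [set p | exists q c, L q /\ p = q + c * b].
have idLb : is_ideal Lb.
  split=> /=.
  - by exists 0, 0; split; rewrite ?mul0r ?addr0.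
  - move=> _ _ [q [c [Lq ->]]] [q' [c' [Lq' ->]]]; exists (q + q'), (c + c').
    by split; [exact: LD | rewrite mulrDl addrACA].
  - move=> r _ [q [c [Lq ->]]]; exists (r * q), (r * c).
    by split; [exact: LM | rewrite mulrDr mulrA].
have [a nza flat] := generic_flatness idLb; exists a => // k ev surj eva p q Lq evbp.
pose T : set {mpoly A[d]} := [set e | exists q c,
  [/\ L q, map_mpoly ev c = 0 & e = q + c * b]].
have [|c _ evc [q1 [c1 [Lq1 ->]]]|||n [q1 [c1 [Lq1 evc1 def_n]]]] :=
    flat k ev T _ _ (b * p - q).
- split=> /=.
  + by exists 0, 0; split; rewrite ?mul0r ?addr0 ?rmorph0.
  + move=> _ _ [q1 [c1 [Lq1 ev1 ->]]] [q2 [c2 [Lq2 ev2 ->]]].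
    exists (q1 + q2), (c1 + c2).
    by split; [exact: LD|rewrite rmorphD /= ev1 ev2 addr0|rewrite mulrDl addrACA].
  + move=> r _ [q1 [c1 [Lq1 ev1 ->]]]; exists (r * q1), (r * c1).
    by split; [exact: LM|rewrite rmorphM /= ev1 mulr0|rewrite mulrDr mulrA].
- exists (c *: q1), (c *: c1); split; first exact: ideal_scale.
    by rewrite map_mpolyZ evc scale0r.
  by rewrite scalerDr scalerAl.
- by exists (- q), p; split; [exact: idealN | rewrite mulrC addrC].
- by rewrite rmorphB /= evbp subrr.
(* [e] lifts the inverse of [ev a ^+ n] and so cancels the power of [a] after specialization. *)
have [e eve] := surj (ev a ^- n).
exists (e *: (a ^+ n *: p - c1)).
  rewrite -scalerAl; apply: ideal_scale => //.
  rewrite mulrBl -scalerAl mulrC; move: def_n.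
  rewrite scalerBr => /(canRL (subrK _)) ->.
  rewrite addrAC addrK; apply: LD => //; exact: ideal_scale.
rewrite map_mpolyZ rmorphB /= evc1 subr0 map_mpolyZ scalerA eve rmorphXn.
by rewrite mulVf ?scale1r // expf_neq0.
Qed.

End GenericDivision.

(** * Torus-stable spaces of polynomials over an infinite field *)

Section InfiniteField.
Variable k : fieldType.
Hypothesis k_inf : infinite_set [set: k].

Lemma infinite_nonroot (q : {poly k}) : q != 0 -> exists t, ~~ root q t.
Proof.
move=> nzq; apply: contrapT => noroot.
have [X _ sX] := infinite_set_fset (size q) k_inf.
have /allP rootX : forall t, t \in finmap.enum_fset X -> root q t.
  by move=> t _; apply: contrapT => /negP ?; apply: noroot; exists t.
by have := max_poly_roots nzq rootX (finmap.fset_uniq X); rewrite ltnNge sX.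
Qed.

Lemma exp_separate (a b : nat) : a != b -> exists2 t : k, t != 0 & t ^+ a != t ^+ b.
Proof.
(* The extra factor ['X] makes the nonroot nonzero. *)
move=> neq_ab; have nzq : 'X * ('X^a - 'X^b) != 0 :> {poly k}.
  rewrite mulf_neq0 ?polyX_eq0 // subr_eq0; apply/eqP => /(congr1 (coefp a)).
  by rewrite /= !coefXn eqxx (negPf neq_ab) => /eqP; rewrite oner_eq0.
have [t] := infinite_nonroot nzq.
rewrite /root !hornerE mulf_eq0 negb_or subr_eq0 => /andP[nzt ne].
by exists t.
Qed.

Variable d : nat.
Implicit Types (t v : 'I_d -> k) (p : {mpoly k[d]}).

Definition torus t : {mpoly k[d]} -> {mpoly k[d]} :=
  mmap (@mpolyC d k) (fun j => t j *: 'X_j).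

HB.instance Definition _ t := GRing.RMorphism.on (torus t).

Lemma torusX t m : torus t 'X_[m] = mmap1 t m *: 'X_[m].
Proof.
rewrite /torus mmapX /mmap1 [in RHS]mpolyXE_id -mul_mpolyC rmorph_prod /=.
by rewrite -big_split; apply: eq_bigr => j _; rewrite exprZn -mul_mpolyC.
Qed.

Lemma torusZ t c p : torus t (c *: p) = c *: torus t p.
Proof. by rewrite /torus mmapZ mul_mpolyC. Qed.

Lemma mcoeff_torus t p m : (torus t p)@_m = mmap1 t m * p@_m.
Proof.
rewrite [p in LHS]mpolyE [p in RHS]mpolyE [torus _ _]rmorph_sum /= !raddf_sum /=.
rewrite mulr_sumr.
apply: eq_bigr => m' _; rewrite torusZ torusX !mcoeffZ mcoeffX.
by case: eqP => [->|_]; rewrite ?mulr0 // mulrCA.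
Qed.

Lemma meval_torus t p v : (torus t p).@[v] = p.@[fun j => t j * v j].
Proof.
rewrite [p]mpolyE [torus _ _]rmorph_sum /= !raddf_sum /=; apply: eq_bigr => m _.
rewrite torusZ torusX !mevalZ !mevalX; congr (_ * _).
by rewrite /mmap1 -big_split; apply: eq_bigr => j _; rewrite exprMn.
Qed.

(** Monomials are eigenvectors of the torus with distinct characters. Subtracting a suitable
    multiple of [p] from a translate of [p] removes one unwanted monomial and keeps [m]. *)
Lemma torus_stable_monomial (K : set {mpoly k[d]}) :
  (forall p q, K p -> K q -> K (p + q)) -> (forall c p, K p -> K (c *: p)) ->
  (forall t p, (forall j, t j != 0) -> K p -> K (torus t p)) ->
  forall p m, K p -> m \in msupp p -> K 'X_[m].
Proof.
move=> KD KZ Kt p m; have [n] := ubnP (size (msupp p)).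
elim: n p => // n IHn p ltpn Kp pm.
have [/allP all_m|/allPn[m' pm' ne_m']] := boolP (all (pred1 m) (msupp p)).
  have pE : p = p@_m *: 'X_[m].
    rewrite {1}[p]mpolyE (bigD1_seq m) //= big1_seq ?addr0 // => m'.
    by case/andP=> ne_m' /all_m; rewrite /= (negPf ne_m').
  move: pm; rewrite mcoeff_msupp => nz_pm.
  rewrite -['X_[m]]scale1r -(mulVf nz_pm) -scalerA -pE; exact: KZ.
have [i ne_i] : exists i, m i != m' i.
  apply: contrapT => same; case/eqP: ne_m'; apply/mnmP => i.
  by apply/esym/eqP; apply: contrapT => /negP ne; apply: same; exists i.
have [t nzt ne_t] := exp_separate ne_i.
pose tt j := if j == i then t else 1.
have ttE m0 : mmap1 tt m0 = t ^+ m0 i.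
  rewrite /mmap1 (bigD1 i) //= /tt eqxx big1 ?mulr1 // => j /negPf ->.
  by rewrite expr1n.
pose q := torus tt p - t ^+ m' i *: p.
have qE m0 : q@_m0 = (t ^+ m0 i - t ^+ m' i) * p@_m0.
  by rewrite mcoeffB mcoeff_torus ttE mcoeffZ mulrBl.
have sub_qp : {subset msupp q <= rem m' (msupp p)}.
  move=> m0; rewrite mem_rem_uniq // !inE !mcoeff_msupp qE mulf_eq0 negb_or.
  case/andP=> ne_m0 ->; rewrite andbT; apply: contraNneq ne_m0 => ->.
  by rewrite subrr.
apply: (IHn q).
- rewrite ltnS in ltpn; apply: leq_ltn_trans (uniq_leq_size _ sub_qp) _ => //.
  by apply: leq_trans ltpn; rewrite size_rem //; case: (msupp p) pm'.
- apply: KD.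
    by apply: Kt => // j; rewrite /tt; case: ifP; rewrite ?oner_neq0.
  by rewrite -scaleNr; apply: KZ.
- by rewrite mcoeff_msupp qE mulf_neq0 -?mcoeff_msupp // subr_eq0.
Qed.

(** Polynomials vanishing everywhere form a torus-stable space. If it were nonzero it would contain
    a monomial, but monomials take the value 1 at the all-ones point. *)
Lemma mpoly_nonvanishing p : p != 0 -> exists v, p.@[v] != 0.
Proof.
move=> nzp; apply: contrapT => vanish.
pose K : set {mpoly k[d]} := [set p | forall v, p.@[v] = 0].
have Kp : K p by move=> v; apply/eqP; apply: contraT => nz; case: vanish; exists v.
suff /(_ (fun=> 1)) : K 'X_[mlead p].
  rewrite mevalX big1 => [/eqP|j _]; first by rewrite oner_eq0.
  exact: expr1n.
apply: torus_stable_monomial Kp (mlead_supp nzp) => [p1 q1 K1 L1|c p1 K1|t p1 _ K1] v /=.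
- by rewrite mevalD K1 L1 addr0.
- by rewrite mevalZ K1 mulr0.
- by rewrite meval_torus; apply: K1.
Qed.

End InfiniteField.

(** * Reductions of an equigenerated monomial ideal *)

Section Reductions.
Variables (A : comNzRingType) (d u : nat) (f : 'I_u -> 'X_{1..d}).
Implicit Types (c : 'I_u -> A) (w : seq 'I_u).

Definition monoprod w : {mpoly A[d]} := \prod_(j <- w) 'X_[f j].

Definition lincomb c : {mpoly A[d]} := \sum_j c j *: 'X_[f j].

Definition linideal n (M : 'I_n -> 'I_u -> A) : set {mpoly A[d]} :=
  ideal_gen (range (fun i => lincomb (M i))).

Definition monideal : set {mpoly A[d]} := ideal_gen (range (fun j => 'X_[A, f j])).

(** The product of [linideal M] with the [N]-th power of [monideal] (see [redidealE]), by explicit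
    generators. *)
Definition redideal n (M : 'I_n -> 'I_u -> A) N : set {mpoly A[d]} :=
  ideal_gen [set lincomb (M i) * monoprod w | i in setT & w in [set w | size w = N]].

(** A single exponent and finitely many monomials express that [linideal M] is a reduction; larger
    exponents follow by [reducing_ge]. *)
Definition reducing n (M : 'I_n -> 'I_u -> A) : Prop :=
  exists N, forall w, size w = N.+1 -> redideal M N (monoprod w).

Lemma monoprod_cons j w : monoprod (j :: w) = 'X_[f j] * monoprod w.
Proof. exact: big_cons. Qed.

Lemma monoprodE w : monoprod w = 'X_[\sum_(j <- w) f j].
Proof. by rewrite /monoprod -mprodXE. Qed.

Lemma ideal_pow_monideal n :
  ideal_pow monideal n = ideal_gen [set monoprod w | w in [set w | size w = n]].
Proof.
elim: n => [|n IHn].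
  apply/seteqP; split=> // p _; have [_ _ GM] := @ideal_gen_ideal {mpoly A[d]}
    [set monoprod w | w in [set w | size w = 0]].
  rewrite -[p]mulr1; apply: GM; apply: sub_ideal_gen; exists [::] => //.
  exact: big_nil.
rewrite -[LHS]/(ideal_mul _ (ideal_pow monideal n)) IHn ideal_mul_gen; congr ideal_gen.
apply/seteqP; split=> [_ [_ [j _ <-] [_ [w sw <-] <-]]|_ [[|j w] // [sw] <-]].
  by exists (j :: w); rewrite /= ?sw // monoprod_cons.
exists 'X_[f j]; first by exists j.
by exists (monoprod w); [exists w | rewrite monoprod_cons].
Qed.

Lemma redidealE n (M : 'I_n -> 'I_u -> A) N :
  ideal_mul (linideal M) (ideal_pow monideal N) = redideal M N.
Proof.
rewrite ideal_pow_monideal ideal_mul_gen; congr ideal_gen.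
apply/seteqP; split=> [_ [_ [i _ <-] [_ [w sw <-] <-]]|_ [i _ [w sw <-]]].
  by exists i => //; exists w.
by exists (lincomb (M i)); [exists i | exists (monoprod w) => //; exists w].
Qed.

Lemma lincomb_monideal c : monideal (lincomb c).
Proof.
apply: ideal_sum_mem; first exact: ideal_gen_ideal.
move=> j _; rewrite -mul_mpolyC.
have [_ _ GM] := ideal_gen_ideal (range (fun j => 'X_[A, f j])).
by apply: GM; apply: sub_ideal_gen; exists j.
Qed.

Lemma linideal_monideal n (M : 'I_n -> 'I_u -> A) : linideal M `<=` monideal.
Proof.
apply: ideal_gen_min; first exact: ideal_gen_ideal.
move=> _ [i _ <-]; exact: lincomb_monideal.
Qed.

Lemma lincomb_homog delta c : (forall j, mdeg (f j) = delta) ->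
  lincomb c \is delta.-homog.
Proof. by move=> homf; apply: rpred_sum => j _; rewrite rpredZ // dhomogX /= homf. Qed.

Lemma monoprod_homog delta w : (forall j, mdeg (f j) = delta) ->
  monoprod w \is (delta * size w).-homog.
Proof.
move=> homf; rewrite monoprodE dhomogX /= mdeg_sum; apply/eqP.
rewrite (eq_bigr (fun=> delta)) // big_const_seq count_predT iter_addn_0.
by [].
Qed.

Lemma redidealS n (M : 'I_n -> 'I_u -> A) N w j :
  redideal M N (monoprod w) -> redideal M N.+1 (monoprod (j :: w)).
Proof.
rewrite monoprod_cons; apply: ideal_gen_mull; first exact: ideal_gen_ideal.
move=> _ [i _ [t st <-]]; rewrite mulrCA -monoprod_cons; apply: sub_ideal_gen.
by exists i => //; exists (j :: t); rewrite //= st.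
Qed.

Lemma reducing_ge n (M : 'I_n -> 'I_u -> A) : reducing M ->
  exists N, forall m w, (N <= m)%N -> size w = m.+1 -> redideal M m (monoprod w).
Proof.
move=> [N HN]; exists N => m w /subnKC <-.
elim: (m - N)%N w => [|e IHe] w; first by rewrite addn0; apply: HN.
by rewrite addnS; case: w => // j w [sw]; apply: redidealS; apply: IHe.
Qed.

Lemma reducing_reduction n (M : 'I_n -> 'I_u -> A) :
  reducing M -> is_reduction monideal (linideal M).
Proof.
move=> /reducing_ge[N HN]; split; first exact: ideal_gen_ideal.
  exact: linideal_monideal.
exists N => m le_Nm; rewrite redidealE; apply/seteqP; split; last first.
  rewrite -redidealE -[X in _ `<=` X]/(ideal_mul _ (ideal_pow monideal m)).
  apply: ideal_gen_mono => _ [a Ma [b Ib <-]].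
  by exists a; [exact: linideal_monideal Ma|exists b].
rewrite ideal_pow_monideal; apply: ideal_gen_min; first exact: ideal_gen_ideal.
by move=> _ [w sw <-]; apply: HN.
Qed.

Lemma reducing_sub n m (M : 'I_n -> 'I_u -> A) (M' : 'I_m -> 'I_u -> A) :
  (forall i, linideal M' (lincomb (M i))) -> reducing M -> reducing M'.
Proof.
move=> sub [N HN]; exists N => w /HN; rewrite -!redidealE; apply: ideal_gen_min.
  exact: ideal_gen_ideal.
move=> _ [a Ma [b Ib <-]]; apply: sub_ideal_gen; exists a; last by exists b.
apply: (ideal_gen_min _ _ Ma); first exact: ideal_gen_ideal.
by move=> _ [i _ <-].
Qed.

End Reductions.

Arguments monideal A {d u} f.
Arguments monoprod A {d u} f w.

(** * Dropping a generator by means of an algebraic relation *)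

Section NoetherNormalization.
Variables (k : fieldType) (d u : nat) (f : 'I_u -> 'X_{1..d}).
Hypothesis k_inf : infinite_set [set: k].

Lemma mmap1_seq n (m : 'X_{1..n}) : exists2 w : seq 'I_n, size w = mdeg m &
  forall (B : comNzRingType) (h : 'I_n -> B), mmap1 h m = \prod_(i <- w) h i.
Proof.
exists (flatten [seq nseq (m i) i | i <- index_enum 'I_n]).
  rewrite size_flatten /shape -map_comp mdegE sumnE big_map.
  by apply: eq_bigr => i _ /=; rewrite size_nseq.
move=> B h; rewrite big_flatten big_map /mmap1; apply: eq_bigr => i _.
by rewrite big_nseq -Monoid.iteropE /=; elim: (m i) => // e IHe; rewrite exprS IHe.
Qed.

Lemma meval_scale n e (t : k) (c : 'I_n -> k) (G : {mpoly k[n]}) :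
  G \is e.-homog -> G.@[fun i => t * c i] = t ^+ e * G.@[c].
Proof.
move=> /dhomogP homG; rewrite !mevalE mulr_sumr; apply: eq_big_seq => m /homG /= <-.
rewrite mulrCA; congr (_ * _); rewrite mdegE -prodrXr -big_split /=.
by apply: eq_bigr => i _; rewrite exprMn.
Qed.

Section Step.
Variables (n : nat) (M : 'I_n.+1 -> 'I_u -> k) (a : 'I_n.+1 -> k).
Hypothesis a0 : a ord0 = 1.

Let y i : {mpoly k[d]} := lincomb f (M i).
Let Y (w : seq 'I_n.+1) := \prod_(i <- w) y i.

(** Coefficients of the forms y_(i+1) - a_(i+1) y_0; modulo these forms, y is proportional to
    [a]. *)
Definition eliminate (i : 'I_n) (j : 'I_u) : k :=
  M (lift ord0 i) j - a (lift ord0 i) * M ord0 j.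

(** For [e > 0] this is J' J^(e-1), where the [y i] generate J and the eliminated forms generate J';
    [H 0] is zero. *)
Let H e : set {mpoly k[d]} :=
  ideal_gen [set lincomb f (eliminate i) * Y w | i in setT & w in [set w | (size w).+1 = e]].

Lemma lincomb_eliminate i :
  lincomb f (eliminate i) = y (lift ord0 i) - a (lift ord0 i) *: y ord0.
Proof.
rewrite /y /lincomb scaler_sumr -sumrB; apply: eq_bigr => j _.
by rewrite scalerBl scalerA.
Qed.

Let H_cons e i p : H e p -> H e.+1 (y i * p).
Proof.
apply: ideal_gen_mull; first exact: ideal_gen_ideal.
move=> _ [j _ [w sw <-]]; apply: sub_ideal_gen; exists j => //.
by exists (i :: w); rewrite /= ?sw // /Y big_cons mulrCA.
Qed.

Let H_diff i w : H (size w).+1 ((y i - a i *: y ord0) * Y w).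
Proof.
have [H0 _ _] := @ideal_gen_ideal {mpoly k[d]} [set lincomb f (eliminate i) * Y w0 |
  i in setT & w0 in [set w0 | (size w0).+1 = (size w).+1]].
case: (unliftP ord0 i) => [j ->|->]; last by rewrite a0 scale1r subrr mul0r.
by rewrite -lincomb_eliminate; apply: sub_ideal_gen; exists j => //; exists w.
Qed.

(** Modulo J' each [y i] equals [a i *: y ord0], so the factors of [Y w] are replaced one by one. *)
Let H_expand w : H (size w) (Y w - (\prod_(i <- w) a i) *: y ord0 ^+ size w).
Proof.
have HI e : is_ideal (H e) by exact: ideal_gen_ideal.
elim: w => [|i w IHw].
  by rewrite /Y !big_nil expr0 scale1r subrr; case: (HI 0%N).
rewrite /Y !big_cons -/(Y w) exprS /=.
have -> : y i * Y w - (a i * \prod_(j <- w) a j) *: (y ord0 * y ord0 ^+ size w) =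
    (y i - a i *: y ord0) * Y w +
    (a i)%:MP * (y ord0 * (Y w - (\prod_(j <- w) a j) *: y ord0 ^+ size w)).
  rewrite mulrBl mulrBr mulrBr mul_mpolyC -scalerAl addrA subrK.
  by rewrite mul_mpolyC -scalerAr scalerA.
have [_ HD HM] := HI (size w).+1.
by apply: HD; [exact: H_diff|apply: HM; apply: H_cons].
Qed.

(** Expanding the monomials of [G] gives 0 = G(y) = G(a) y_0^(e+1) modulo J' J^e, so y_0^(e+1), and
    with it J^(e+1), lies in J' J^e. As I^(e+1+N) lies in J^(e+1) I^N, it lies in J' I^(e+N). *)
Lemma eliminate_reducing e (G : {mpoly k[n.+1]}) : G \is e.+1.-homog ->
  G.@[a] != 0 -> mmap (@mpolyC d k) y G = 0 -> reducing f M ->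
  reducing f eliminate.
Proof.
move=> homG nzG Gy [N HN]; have /dhomogP dG := homG.
have HI e' : is_ideal (H e') by exact: ideal_gen_ideal.
have Hy0 : H e.+1 (y ord0 ^+ e.+1).
  have [_ _ HM] := HI e.+1.
  have -> : y ord0 ^+ e.+1 = (- (G.@[a])^-1)%:MP *
      (mmap (@mpolyC d k) y G - G.@[a] *: y ord0 ^+ e.+1).
    by rewrite Gy sub0r mul_mpolyC scalerN scaleNr opprK scalerA mulVf ?scale1r.
  apply: (HM); rewrite /meval {1}/mmap {1}/mmap scaler_suml -sumrB.
  rewrite big_seq; apply: ideal_sum_mem => // m /dG /= dm.
  have [w sw wE] := mmap1_seq m; rewrite !wE mul_mpolyC -scalerA -scalerBr.
  apply: (ideal_scale (L := H e.+1)) => //; have := @H_expand w; by rewrite sw dm.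
have HY w : (e < size w)%N -> H (size w) (Y w).
  move=> lt_ew; have [_ HD HM] := HI (size w).
  rewrite -[Y w](subrK ((\prod_(i <- w) a i) *: y ord0 ^+ size w)).
  apply: HD; first exact: H_expand.
  rewrite -mul_mpolyC; apply: HM; rewrite -(subnK lt_ew).
  by elim: (_ - _)%N => // m IHm; rewrite addSn exprS; apply: H_cons.
have Ypow w : ideal_pow (monideal k f) (size w) (Y w).
  elim: w => [|i w IHw] //; rewrite /Y big_cons.
  apply: sub_ideal_gen; exists (y i); first exact: lincomb_monideal.
  by exists (Y w).
(* [T m] is J^m I^N; [TP] iterates the hypothesis on [M] to put I^(m+N) inside it. *)
pose T m := ideal_gen [set Y v * monoprod k f t |
  v in [set v | size v = m] & t in [set t | size t = N]].
have TI m : is_ideal (T m) by exact: ideal_gen_ideal.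
have TP m w : size w = (m + N)%N -> T m (monoprod k f w).
  elim: m w => [|m IHm] w sw.
    apply: sub_ideal_gen; exists [::] => //; exists w => //.
    by rewrite /Y big_nil mul1r.
  case: w sw => // j w [/IHm]; rewrite monoprod_cons.
  apply: ideal_gen_mull => // _ [v sv [t st <-]].
  rewrite mulrCA -monoprod_cons.
  have := HN (j :: t); rewrite /= st => /(_ erefl).
  apply: ideal_gen_mull => // _ [i _ [t' st' <-]]; apply: sub_ideal_gen.
  exists (i :: v); first by rewrite /= sv.
  by exists t' => //; rewrite /Y big_cons mulrCA mulrA.
exists (e + N)%N => w sw; rewrite -redidealE.
set K := ideal_mul _ _; have idK : is_ideal K by exact: ideal_gen_ideal.
apply: (ideal_gen_min _ _ (TP e.+1 w sw)) => // _ [v sv [t st <-]].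
rewrite mulrC; have := HY v; rewrite sv => /(_ (leqnn _)).
apply: ideal_gen_mull => // _ [i _ [v' [sv'] <-]]; rewrite mulrCA.
apply: sub_ideal_gen; exists (lincomb f (eliminate i)).
  by apply: sub_ideal_gen; exists i.
exists (Y v' * monoprod k f t); last by rewrite [Y v' * _]mulrC.
rewrite -sv'; apply: ideal_powM => //; rewrite -st ideal_pow_monideal.
by apply: sub_ideal_gen; exists t.
Qed.

End Step.

Lemma noether_step n (M : 'I_n.+1 -> 'I_u -> k) e (G : {mpoly k[n.+1]}) :
  G \is e.-homog -> G != 0 ->
  mmap (@mpolyC d k) (fun i => lincomb f (M i)) G = 0 -> reducing f M ->
  exists2 M' : 'I_n -> 'I_u -> k, reducing f M' &
    forall i, linideal f M (lincomb f (M' i)).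
Proof.
(* Multiplying by the first variable makes the first coordinate of a
   nonvanishing point nonzero. *)
move=> homG nzG Gy redM; pose G' := G * 'X_ord0.
have homG' : G' \is e.+1.-homog.
  by rewrite -[e.+1]addn1; apply: dhomogM => //; rewrite dhomogX /= mdeg1.
have [|c] := mpoly_nonvanishing k_inf (p := G').
  by rewrite mulf_neq0 // -msupp_eq0 msuppX.
move=> nzc; have nzc0 : c ord0 != 0.
  by apply: contraNneq nzc => c0; rewrite mevalM mevalXU c0 mulr0.
(* Homogeneity allows rescaling the point so that its first coordinate is 1. *)
pose a i := (c ord0)^-1 * c i.
exists (eliminate M a); last first.
  move=> i; rewrite lincomb_eliminate.
  apply: (idealB (K := linideal f M)); first exact: ideal_gen_ideal.
    by apply: sub_ideal_gen; exists (lift ord0 i).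
  rewrite -mul_mpolyC; have [_ _ GM] := ideal_gen_ideal (range (fun i => lincomb f (M i))).
  by apply: GM; apply: sub_ideal_gen; exists ord0.
apply: (eliminate_reducing _ homG') => //; first exact: mulVf.
  by rewrite /a (meval_scale _ _ homG') mulf_neq0 // expf_neq0 // invr_eq0.
by rewrite /G' rmorphM /= Gy mul0r.
Qed.

End NoetherNormalization.

(** * Prime chains in integral extensions of polynomial rings *)

Section PrimeSets.
Variable B : comNzRingType.
Implicit Type K : set B.

Definition is_prime K : Prop :=
  [/\ is_ideal K, ~ K 1 & forall a b, K (a * b) -> K a \/ K b].

Section Pack.
Variables (K : set B) (prK : is_prime K).

Definition prime_pred : {pred B} := fun x => `[< K x >].

Let prime_pred_ideal : idealr_closed prime_pred.
Proof.
have [[K0 KD KM] K1 _] := prK; split; first exact/asboolP.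
  by apply/negP => /asboolP.
by move=> a x y /asboolP Kx /asboolP Ky; apply/asboolP; apply: KD => //; apply: KM.
Qed.

Let prime_pred_prime : prime_idealr_closed prime_pred.
Proof.
have [_ _ Kp] := prK; move=> a b /asboolP /Kp Kab.
by apply/orP; case: Kab => ?; [left|right]; apply/asboolP.
Qed.

HB.instance Definition _ := isIdealr.Build B prime_pred prime_pred_ideal.
HB.instance Definition _ := isPrimeIdealrClosed.Build B prime_pred prime_pred_prime.

Definition prime_of_set : prime_idealr B := prime_pred.

Lemma mem_prime_of_set x : x \in prime_of_set <-> K x.
Proof. by split => /asboolP. Qed.

End Pack.

Lemma kernel_prime (D : idomainType) (psi : {rmorphism B -> D}) :
  is_prime [set a | psi a = 0].
Proof.
split=> [|/= |a b /=].
- split=> /= [|a b pa pb|r a pa]; first exact: rmorph0.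
  + by rewrite rmorphD pa pb addr0.
  + by rewrite rmorphM pa mulr0.
- by rewrite rmorph1 => /eqP; rewrite oner_eq0.
- by rewrite rmorphM => /eqP; rewrite mulf_eq0 => /orP[] /eqP; [left|right].
Qed.

End PrimeSets.

Section GoingUp.
Variables (A B : comNzRingType) (phi : {rmorphism A -> B}).
Hypothesis integral_phi :
  forall b, exists2 p : {poly A}, p \is monic & (map_poly phi p).[b] = 0.

(** [P] is maximal among the ideals over [P0] that contract into [q]. Maximality gives primality;
    integrality makes the contraction equal to [q]. *)
Lemma going_up (q : set A) (P0 : set B) : is_prime q -> is_ideal P0 ->
  phi @^-1` P0 `<=` q ->
  exists P, [/\ is_prime P, P0 `<=` P & phi @^-1` P = q].
Proof.
move=> prq idP0 P0q; have [idq q1 qM] := prq; have [q0 qD qI] := idq.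
pose good (K : set B) := [/\ is_ideal K, P0 `<=` K & phi @^-1` K `<=` q].
(* The empty chain has union [set0], hence the alternative beside [good]. *)
have [P [Pgood Pmax]] : exists P : set B, (P = set0 \/ good P) /\
    forall K, P `<` K -> ~ (K = set0 \/ good K).
  apply: Zorn_bigcup => F Fgood totF.
  have [[K0 FK0 gK0]|noK] := pselect (exists2 K, F K & good K); last first.
    left; apply/seteqP; split=> // x [K FK Kx].
    have [K0|gK] := Fgood K FK; first by rewrite K0 in Kx.
    by case: noK; exists K.
  have [[K00 _ _] P0K0 _] := gK0.
  have Fg K x : F K -> K x -> good K.
    by move=> FK Kx; case: (Fgood K FK) => // K_0; rewrite K_0 in Kx.
  right; split.
  - split; first by exists K0.
    + move=> a b [K FK Ka] [L FL Lb].
      have [[_ KD _] _ _] := Fg _ _ FK Ka; have [[_ LD _] _ _] := Fg _ _ FL Lb.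
      have [KL|LK] := totF K L FK FL.
        by exists L => //; apply: LD => //; apply: KL.
      by exists K => //; apply: KD => //; apply: LK.
    + move=> r a [K FK Ka]; have [[_ _ KM] _ _] := Fg _ _ FK Ka.
      by exists K => //; apply: KM.
  - by move=> x /P0K0 K0x; exists K0.
  - by move=> x [K FK Kx]; have [_ _] := Fg _ _ FK Kx; apply.
have {Pgood}[idP P0P Pq] : good P.
  case: Pgood => // P_0; case: (Pmax P0).
    by rewrite P_0; split=> // /(_ 0); case: idP0 => P00 _ _ /(_ P00).
  by right; split.
have [PO PD PM] := idP.
(* Enlarging [P] by [x] must break the condition on contractions. *)
have maxP x : ~ P x -> exists s c b, [/\ ~ q s, P c & phi s = c + b * x].
  move=> nPx; apply: contrapT => nos.
  pose K : set B := [set y | exists c b, P c /\ y = c + b * x].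
  have PK : P `<=` K by move=> y Py; exists y, 0; rewrite mul0r addr0.
  apply: (Pmax K).
    split=> // KP; apply: nPx; apply: KP; exists 0, 1; split=> //.
    by rewrite add0r mul1r.
  right; split.
  - split; first exact: PK.
    + move=> _ _ [c [b [Pc ->]]] [c' [b' [Pc' ->]]]; exists (c + c'), (b + b').
      by split; [exact: PD | rewrite mulrDl addrACA].
    + move=> r _ [c [b [Pc ->]]]; exists (r * c), (r * b).
      by split; [exact: PM | rewrite mulrDr mulrA].
  - by move=> y /P0P; apply: PK.
  - move=> s [c [b [Pc sE]]]; apply: contrapT => nqs; apply: nos.
    by exists s, c, b.
exists P; split=> //.
  split=> // [P1|a b Pab]; first by apply: q1; apply: Pq; rewrite /= rmorph1.
  apply: contrapT => /not_orP[nPa nPb].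
  have [s [c [e [nqs Pc sE]]]] := maxP a nPa.
  have [s' [c' [e' [nqs' Pc' sE']]]] := maxP b nPb.
  have : q (s * s').
    apply: Pq; rewrite /= rmorphM sE sE' mulrDl !mulrDr.
    have -> : e * a * (e' * b) = (e * e') * (a * b) by rewrite mulrACA.
    apply: (PD); first by apply: (PD); [apply: (PM) | rewrite mulrC; apply: (PM)].
    by apply: (PD); apply: (PM).
  by case/qM.
apply/seteqP; split=> // y qy /=; apply: contrapT => nPy.
have [s [c [b [nqs Pc sE]]]] := maxP _ nPy.
have [p monp rootp] := integral_phi b.
(* [e] is the monic equation of [b] homogenized in [s] and [y]. As [phi s] is [b * phi y] modulo
   [P], [phi e] lies in [P], so [e] lies in [q]; since [y] lies in [q], only [s ^+ m] survives
   there. *)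
pose m := (size p).-1; pose e := \sum_(i < size p) p`_i * y ^+ (m - i) * s ^+ i.
have szp : size p = m.+1 by rewrite /m prednK // size_poly_gt0 monic_neq0.
have root0 : \sum_(i < size p) phi (p`_i * y ^+ (m - i)) * (b * phi y) ^+ i = 0.
  transitivity (phi y ^+ m * (map_poly phi p).[b]); last by rewrite rootp mulr0.
  rewrite horner_poly mulr_sumr.
  apply: eq_bigr => i _; have le_im : (i <= m)%N by rewrite -ltnS -szp.
  have -> : phi y ^+ m = phi y ^+ (m - i) * phi y ^+ i by rewrite -exprD subnK.
  by rewrite rmorphM rmorphXn /= exprMn mulrACA [RHS]mulrC.
have Pe : P (phi e).
  have -> : phi e = \sum_(i < size p) (phi (p`_i * y ^+ (m - i)) *
                      (phi s ^+ i - (b * phi y) ^+ i)).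
    under eq_bigr do rewrite mulrBr.
    rewrite sumrB root0 subr0 rmorph_sum.
    by apply: eq_bigr => i _; rewrite rmorphM rmorphXn.
  apply: ideal_sum_mem => // i _; apply: (PM); rewrite subrXX mulrC; apply: (PM).
  by rewrite sE addrK.
have /= qe := Pq _ Pe; case: nqs.
have qsm : q (s ^+ m).
  have -> : s ^+ m = e - \sum_(i < m) p`_i * y ^+ (m - i) * s ^+ i.
    have pm1 : p`_m = 1 by apply/eqP; rewrite -[_ == 1]/(_ \is monic).
    by rewrite /e szp big_ord_recr /= subnn expr0 mulr1 pm1 mul1r [RHS]addrC addKr.
  apply: idealB => //; apply: ideal_sum_mem => // i _.
  have lt_im : (0 < m - i)%N by rewrite subn_gt0.
  by rewrite mulrAC -(prednK lt_im) exprSr mulrA; apply: qI.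
move: qsm; elim: {+}m => [|i IHi]; first by rewrite expr0.
by rewrite exprS => /qM[].
Qed.

End GoingUp.

Section IntegralChain.
Variables (A B : comNzRingType) (phi : {rmorphism A -> B}).

(** Cayley-Hamilton: [b] minus a matrix of multiplication by [b] annihilates the vector of
    generators, so its determinant annihilates [g ord0 = 1]. *)
Lemma module_finite_integral n (g : 'I_n.+1 -> B) : g ord0 = 1 ->
  (forall b, exists c : 'I_n.+1 -> A, b = \sum_i phi (c i) * g i) ->
  forall b, exists2 p : {poly A}, p \is monic & (map_poly phi p).[b] = 0.
Proof.
move=> g0 gen b; have [c cE] := choice (fun i => gen (b * g i)).
pose a := \matrix_(i, j) c i j.
exists (char_poly a); first exact: char_poly_monic.
have comm_b : commr_rmorph phi b by move=> x; apply: mulrC.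
rewrite -[LHS]/(horner_morph comm_b (char_poly a)) /char_poly -det_map_mx.
rewrite -[\det _]mulr1 -g0.
apply: (@adjugate_ideal B n.+1 [set 0]) => [|i].
  split=> [|x y -> ->|r x ->] //=; [exact: addr0 | exact: mulr0].
rewrite /= (eq_bigr (fun j => b *+ (i == j) * g j - phi (c i j) * g j)).
  rewrite sumrB -cE (bigD1 i) //= eqxx big1 ?addr0 ?subrr // => j.
  by rewrite eq_sym => /negPf ->; rewrite mul0r.
move=> j _; rewrite !mxE rmorphB rmorphMn /= horner_morphX horner_morphC.
exact: mulrBl.
Qed.

End IntegralChain.

(** The primes generated by the first [i] variables, kernels of the maps [psi i], are lifted to [B]
    by repeated going-up. *)
Lemma polynomial_prime_chain (k : fieldType) n (B : comNzRingType)
    (phi : {rmorphism {mpoly k[n]} -> B}) :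
  (forall p, phi p = 0 -> p = 0) ->
  (forall b, exists2 p : {poly {mpoly k[n]}}, p \is monic & (map_poly phi p).[b] = 0) ->
  prime_chain B n.
Proof.
move=> phi_inj int.
pose psi (i : nat) : {rmorphism {mpoly k[n]} -> {mpoly k[n]}} :=
  mmap (@mpolyC n k) (fun j => if (j < i)%N then 0 else 'X_j).
pose q i := [set p | psi i p = 0].
have prq i : is_prime (q i) by exact: kernel_prime.
have psiX i j : psi i 'X_j = if (j < i)%N then 0 else 'X_j.
  by rewrite /psi /= mmapX mmap1U.
have q0 p : p = 0 -> q 0%N p by move=> ->; exact: rmorph0.
have qS i : q i `<=` q i.+1.
  have psiS p : psi i.+1 (psi i p) = psi i.+1 p.
    rewrite [p]mpolyE (rmorph_sum (psi i)) !(rmorph_sum (psi i.+1)).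
    apply: eq_bigr => m _.
    rewrite -mul_mpolyC !rmorphM /= !mmapC !mmapX; congr (_ * _).
    rewrite /mmap1 rmorph_prod; apply: eq_bigr => j _; rewrite rmorphXn /=.
    congr (_ ^+ _); case: ifP => [lt_ji|_]; last by rewrite mmapX mmap1U.
    by rewrite rmorph0 ltnS ltnW.
  by move=> p /= psip; rewrite /q /= -psiS psip rmorph0.
(* A going-up step chosen for every pair lets the chain [P] be defined by recursion. *)
have /choice[h hP] : forall iP : nat * set B, exists P,
    is_ideal iP.2 -> phi @^-1` iP.2 `<=` q iP.1 ->
    [/\ is_prime P, iP.2 `<=` P & phi @^-1` P = q iP.1].
  move=> [i P]; have [[idP Pq]|nP] := pselect (is_ideal P /\ phi @^-1` P `<=` q i).
    by have [P' HP'] := going_up int (prq i) idP Pq; exists P'.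
  by exists P => idP Pq; case: nP.
pose P := fix P i := if i is j.+1 then h (i, P j) else h (0%N, [set 0]).
have PP i : is_prime (P i) /\ phi @^-1` (P i) = q i.
  elim: i => [|i [prP PE]].
    have [||] // := hP (0%N, [set 0]).
      split=> [|x y -> ->|r x ->] //=; [exact: addr0 | exact: mulr0].
    by move=> p /phi_inj /q0.
  have [||] // := hP (i.+1, P i); first by case: prP.
  by rewrite PE; exact: qS.
have PS i : P i `<=` P i.+1.
  have [prP PE] := PP i.
  have [||] // := hP (i.+1, P i); first by case: prP.
  by rewrite PE; exact: qS.
have Ple i j : (i <= j)%N -> P i `<=` P j.
  move=> /subnKC <-; elim: (j - i)%N => [|e IHe]; first by rewrite addn0.
  by rewrite addnS; apply: subset_trans IHe (PS _).
exists (fun i => prime_of_set (PP i).1) => i j lt_ij; split.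
  move=> x /mem_prime_of_set Px; apply/mem_prime_of_set.
  exact: Ple (ltnW lt_ij) _ Px.
have lt_in : (i < n)%N by apply: leq_trans lt_ij _; rewrite -ltnS.
pose x := phi 'X_(Ordinal lt_in).
move=> /(_ x) sub; have : x \in prime_of_set (PP i).1.
  apply: sub; apply/mem_prime_of_set; apply: (Ple i.+1) => //.
  suff : (phi @^-1` (P i.+1)) 'X_(Ordinal lt_in) by [].
  by rewrite (PP i.+1).2 /q /= psiX /= ltnSn.
move=> /mem_prime_of_set; rewrite -[P i x]/((phi @^-1` (P i)) 'X_(Ordinal lt_in)).
rewrite (PP i).2 /q /= psiX /= ltnn => /eqP.
by rewrite -msupp_eq0 msuppX.
Qed.

(** * The special fiber ring *)

Lemma irrelevant_ideal_coef0 (k : fieldType) d (p : {mpoly k[d]}) :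
  p@_0%MM = 0 -> @irrelevant_ideal k d p.
Proof.
move=> p0; rewrite [p]mpolyE big_seq; apply: ideal_sum_mem.
  exact: ideal_gen_ideal.
move=> m mp; apply: (ideal_scale (L := @irrelevant_ideal k d)); first exact: ideal_gen_ideal.
have [i nz_mi] : exists i, m i != 0%N.
  apply: contrapT => m0; move: mp; rewrite mcoeff_msupp => /eqP; case.
  suff -> : m = 0%MM by [].
  apply/mnmP => i; rewrite mnm0E; apply/eqP; apply: contrapT => /negP ?.
  by apply: m0; exists i.
have := nz_mi; rewrite -lep1mP => /submK <-; rewrite mpolyXD.
have [_ _ GM] := @ideal_gen_ideal _ (range (fun i : 'I_d => 'X_i : {mpoly k[d]})).
by apply: GM; apply: sub_ideal_gen; exists i.
Qed.

Section SpecialFiberChain.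
Variables (k : fieldType) (d u : nat) (f : 'I_u -> 'X_{1..d}).

Let I := monideal k f.
Local Open Scope quotient_scope.
Let Q : comNzRingType := special_fiber I.
Let pi : {rmorphism rees I -> Q} := \pi_(special_fiber I).
Let rval : {rmorphism rees I -> {poly {mpoly k[d]}}} := val.

Lemma rees_monomial_subproof e p : ideal_pow I e p -> p *: 'X^e \in rees_pred I.
Proof.
move=> Ip; apply/asboolP => n; rewrite coefZ coefXn.
case: eqP => [->|_]; first by rewrite mulr1.
by rewrite mulr0; case: (ideal_pow_ideal I n).
Qed.

Definition rees_monomial e p (Ip : ideal_pow I e p) : rees I :=
  Rees (rees_monomial_subproof Ip).

Definition rees_const (r : {mpoly k[d]}) : rees I :=
  @rees_monomial 0 r Logic.I.

Lemma rees_const_additive : zmod_morphism rees_const.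
Proof. by move=> x y; apply: val_inj; rewrite /= !expr0 scalerBl. Qed.

Lemma rees_const_multiplicative : monoid_morphism rees_const.
Proof.
split=> [|x y]; apply: val_inj; rewrite /= ?expr0 ?scale1r //.
by rewrite !alg_polyC polyCM.
Qed.

HB.instance Definition _ :=
  GRing.isZmodMorphism.Build _ _ rees_const rees_const_additive.
HB.instance Definition _ :=
  GRing.isMonoidMorphism.Build _ _ rees_const rees_const_multiplicative.

Let rees_scalar : {rmorphism k -> rees I} := rees_const \o @mpolyC d k.

Lemma ideal_pow1 p : I p -> ideal_pow I 1 p.
Proof. by rewrite /ideal_pow /= ideal_mulr. Qed.

Variables (n : nat) (M : 'I_n -> 'I_u -> k).

Let y i : {mpoly k[d]} := lincomb f (M i).
Let yt i : rees I := rees_monomial (ideal_pow1 (@lincomb_monideal k d u f (M i))).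

Let phiR : {rmorphism {mpoly k[n]} -> rees I} := mmap rees_scalar yt.
(** Sends the [i]-th variable to the class of [y i] placed in degree one of the Rees algebra. *)
Let phi : {rmorphism {mpoly k[n]} -> Q} := pi \o phiR.

Lemma rval_phiR G e :
  (rval (phiR G))`_e = mmap (@mpolyC d k) y (pihomog mdeg e G).
Proof.
have X1 m : rval (mmap1 yt m) = mmap1 y m *: 'X^(mdeg m).
  rewrite /mmap1 rmorph_prod (eq_bigr (fun i => (y i ^+ m i)%:P * 'X^(m i))).
    rewrite big_split /= -rmorph_prod mdegE -mul_polyC; congr (_ * _).
    by rewrite -prodrXr.
  move=> i _; rewrite (rmorphXn rval); have -> : rval (yt i) = y i *: 'X by rewrite /= expr1.
  by rewrite exprZn mul_polyC.
rewrite -[phiR G]/(mmap rees_scalar yt G) [in LHS]/mmap (rmorph_sum rval) coef_sum.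
rewrite pihomogE rmorph_sum [RHS]big_mkcond; apply: eq_bigr => m _.
rewrite (rmorphM rval) X1 /= expr0 alg_polyC coefCM coefZ coefXn.
rewrite eq_sym; case: eqP => _; last by rewrite !mulr0.
by rewrite mulr1 mmapZ mmapX.
Qed.

Variable delta : nat.
Hypothesis homf : forall j, mdeg (f j) = delta.

(* [m I^e] lives in degrees above [delta * e]. *)
Lemma fiber_ideal_homog_eq0 e p :
  ideal_mul (@irrelevant_ideal k d) (ideal_pow I e) p ->
  p \is (delta * e).-homog -> p = 0.
Proof.
move=> mIp homp; rewrite -(pihomog_dE homp).
move: mIp; rewrite ideal_pow_monideal ideal_mul_gen => mIp.
pose K : set {mpoly k[d]} :=
  [set p | forall r, pihomog mdeg (delta * e) (r * p) = 0].
suff : K p by move=> /(_ 1); rewrite mul1r.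
apply: (ideal_gen_min _ _ mIp).
  rewrite /K; split=> /= [r|a b Ka Kb r|r a Ka s].
  - by rewrite mulr0 linear0.
  - by rewrite mulrDr linearD /= Ka Kb addr0.
  - by rewrite mulrA Ka.
move=> _ [_ [i _ <-] [_ [w sw <-] <-]] r.
apply: (@pihomogM_lt _ _ _ (1 + delta * e)) => //.
by apply: dhomogM; [rewrite dhomogX /= mdeg1|rewrite -sw; exact: monoprod_homog].
Qed.

Hypothesis free_y : forall e (G : {mpoly k[n]}), G \is e.-homog ->
  mmap (@mpolyC d k) y G = 0 -> G = 0.

(** The degree [e] component of [G] evaluates at [y] to an element of m I^e of degree [delta * e],
    which must vanish; [free_y] then kills the component. *)
Lemma phi_inj G : phi G = 0 -> G = 0.
Proof.
move=> phiG0.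
have fibG : fiber_ideal I (phiR G).
  have : phiR G - 0 \in fiber_ideal I.
    by rewrite Quotient.idealrBE; apply/eqP; rewrite [LHS]phiG0 rmorph0.
  by rewrite subr0.
rewrite [LHS](pihomog_partitionE (leqnn (mmeasure mdeg G))) big1 // => e _.
apply: (@free_y e); first exact: pihomogP.
move/asboolP: fibG => /(_ e) /=; rewrite -[(rees_val _)`_e]/((rval (phiR G))`_e).
rewrite rval_phiR => /fiber_ideal_homog_eq0; apply.
have /dhomogP dG := pihomogP mdeg e G.
rewrite /mmap big_seq; apply: rpred_sum => m /dG /= dm.
rewrite mul_mpolyC rpredZ //; have [w sw ->] := mmap1_seq m.
rewrite -dm -sw; elim: w {sw} => [|i w IHw]; first by rewrite big_nil muln0 dhomog1.
by rewrite big_cons mulnS; apply: dhomogM => //; apply: lincomb_homog.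
Qed.

Hypothesis redM : reducing f M.

(** Words of length at most [N] in the monomial generators span the special fiber as a module over
    [{mpoly k[n]}], because [redM] rewrites longer ones. Hence the fiber is integral over this
    ring. *)
Lemma special_fiber_chain : prime_chain Q n.
Proof.
apply: (polynomial_prime_chain phi_inj).
have [N HN] := reducing_ge redM.
pose xt j : rees I :=
  rees_monomial (ideal_pow1 (sub_ideal_gen
    (ex_intro2 _ _ j Logic.I erefl : range (fun j => 'X_[k, f j]) _))).
pose wt w := \prod_(j <- w) xt j.
(* The empty word in front makes the first module generator 1. *)
pose L : seq (seq 'I_u) :=
  [::] :: flatten [seq [seq val t | t : m.-tuple 'I_u] | m <- iota 0 N.+1].
have memL w : (size w <= N)%N -> w \in L.
  move=> le_wN; rewrite inE; apply/orP; right; apply/flattenP.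
  exists [seq val t | t : (size w).-tuple 'I_u].
    by apply: (map_f (fun m => [seq val t | t : m.-tuple 'I_u])); rewrite mem_iota ltnS.
  by apply/mapP; exists (in_tuple w); rewrite ?mem_enum.
pose m := (size L).-1.
pose g (i : 'I_m.+1) := pi (wt (nth [::] L i)).
apply: (@module_finite_integral _ _ phi m g).
  by rewrite /g /wt /= big_nil rmorph1.
pose S : set Q := [set b | exists c, b = \sum_i phi (c i) * g i].
have S0 : S 0 by exists (fun=> 0); rewrite big1 // => i _; rewrite rmorph0 mul0r.
have SD a b : S a -> S b -> S (a + b).
  move=> [c ->] [e ->]; exists (fun i => c i + e i).
  by rewrite -big_split; apply: eq_bigr => i _; rewrite rmorphD mulrDl.
have SM r b : S b -> S (phi r * b).
  move=> [c ->]; exists (fun i => r * c i).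
  by rewrite mulr_sumr; apply: eq_bigr => i _; rewrite rmorphM mulrA.
have Ssmall w : (size w <= N)%N -> S (pi (wt w)).
  move=> /memL Lw; have lt_wL : (index w L < m.+1)%N by rewrite index_mem.
  exists (fun i => if i == Ordinal lt_wL then 1 else 0).
  rewrite (bigD1 (Ordinal lt_wL) isT) eqxx (rmorph1 phi) mul1r /g nth_index //.
  rewrite big1 ?Monoid.mulm1 // => i /andP[_ /negPf ->].
  by rewrite (rmorph0 phi) mul0r.
(* Modulo the irrelevant ideal an element of degree zero equals its constant term. *)
have pi_const r : pi (rees_const r) = phi (r@_0%MM)%:MP.
  have -> : phi (r@_0%MM)%:MP = pi (rees_const (r@_0%MM)%:MP).
    suff -> : rees_const (r@_0%MM)%:MP = phiR (r@_0%MM)%:MP by [].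
    by rewrite /phiR /= mmapC.
  apply/eqP; rewrite -Quotient.idealrBE -rmorphB.
  apply/asboolP => e; rewrite coefZ coefXn; case: eqP => [->|_].
    rewrite mulr1 [ideal_pow _ _]/(setT) ideal_mulr; apply: irrelevant_ideal_coef0.
    by rewrite mcoeffB mcoeffC eqxx mulr1 subrr.
  rewrite mulr0; case: (@ideal_gen_ideal {mpoly k[d]}
    [set a * b | a in @irrelevant_ideal k d & b in ideal_pow I e]) => //.
(* Coefficients of t^e whose class lies in the span [S]. They form an ideal because polynomials act
   through their constant terms. *)
pose W e : set {mpoly k[d]} :=
  [set p | exists2 rho, rval rho = p *: 'X^e & S (pi rho)].
have idW e : is_ideal (W e).
  split=> [|p q [rho rhoE Srho] [sigma sigmaE Ssigma]|r p [rho rhoE Srho]].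
  - by exists 0; rewrite ?rmorph0 ?scale0r.
  - exists (rho + sigma); first by rewrite (rmorphD rval) rhoE sigmaE scalerDl.
    by rewrite (rmorphD pi); apply: SD.
  - exists (rees_const r * rho); last by rewrite (rmorphM pi) pi_const; apply: SM.
    rewrite (rmorphM rval) rhoE -[rval (rees_const r)]/(r *: 'X^0) expr0.
    by rewrite -scalerAl mul1r scalerA.
have wtE w : rval (wt w) = monoprod k f w *: 'X^(size w).
  elim: w => [|j w IHw]; first by rewrite /wt /monoprod !big_nil rmorph1 scale1r.
  rewrite /wt big_cons -/(wt w) (rmorphM rval) IHw monoprod_cons.
  by rewrite -[rval (xt j)]/('X_[f j] *: 'X^1) -scalerAl -scalerAr scalerA -exprD add1n.
(* Induction on length: a word longer than [N] is a combination of products of some [y i] with words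
   shorter by one. *)
have Swt w : S (pi (wt w)).
  have [e] := ubnP (size w); elim: e w => // e IHe w; rewrite ltnS => le_we.
  have [/Ssmall //|lt_Nw] := leqP (size w) N.
  have [e' sw] : exists e', size w = e'.+1 by exists (size w).-1; rewrite (ltn_predK lt_Nw).
  rewrite sw ltnS in lt_Nw.
  have [rho rhoE Srho] : W e'.+1 (monoprod k f w).
    apply: (ideal_gen_min _ _ (HN _ _ lt_Nw sw)) => // _ [i _ [t st <-]].
    exists (yt i * wt t).
      rewrite (rmorphM rval) wtE st -[rval (yt i)]/(y i *: 'X^1).
      by rewrite -scalerAl -scalerAr scalerA -exprD add1n.
    have -> : yt i = phiR 'X_i by rewrite /phiR /= mmapX mmap1U.
    by rewrite (rmorphM pi); apply: SM; apply: IHe; rewrite st -ltnS -sw.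
  by suff <- : rho = wt w by []; apply: val_inj; rewrite [LHS]rhoE -sw -wtE.
have Wpow e p : ideal_pow I e p -> W e p.
  rewrite ideal_pow_monideal; apply: ideal_gen_min => // _ [w <- <-].
  by exists (wt w).
move=> b; rewrite -[b]reprK; set rho := repr b.
pose V : set {poly {mpoly k[d]}} := [set q | exists2 sigma, rval sigma = q & S (pi sigma)].
suff [sigma /val_inj -> //] : V (rval rho).
rewrite -[rval rho]coefK poly_def; apply: (big_ind V).
- by exists 0; rewrite ?rmorph0.
- move=> _ _ [s <- Ss] [t <- St]; exists (s + t); first exact: (rmorphD rval).
  by rewrite (rmorphD pi); apply: SD.
move=> i _; have [//|sigma sigmaE Ssigma] := Wpow i (rval rho)`_i; last by exists sigma.
by have /asboolP := valP rho; apply.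
Qed.

End SpecialFiberChain.

(** * Homogeneous reductions and specialized ideals *)

Section ReductionsContainGeneral.
Variables (k : fieldType) (d u delta : nat) (f : 'I_u -> 'X_{1..d}).
Hypothesis k_inf : infinite_set [set: k].
Hypothesis homf : forall j, mdeg (f j) = delta.

Lemma homogeneous_monideal : homogeneous_ideal (monideal k f).
Proof.
exists (range (fun j => 'X_[k, f j])); split=> // _ [j _ <-].
by exists delta; rewrite dhomogX /= homf.
Qed.

(** Only constant terms of the coefficients contribute in degree [delta]. *)
Lemma pihomog_monideal p : monideal k f p ->
  exists c, pihomog mdeg delta p = lincomb f c.
Proof.
move=> /ideal_gen_imageP[c ->]; exists (fun j => (c j)@_0%MM).
rewrite linear_sum; apply: eq_bigr => j _ /=.
rewrite -[in LHS](add0n delta) (pihomogM _ (e := delta)) ?dhomogX /= ?homf //.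
by rewrite pihomog0E mul_mpolyC.
Qed.

(** Comparing parts of degree [delta * N.+1] in I^(N+1) = L I^N replaces elements of [L] by their
    components of degree [delta], which stay in [L] by homogeneity. Finitely many of them
    suffice. *)
Lemma reduction_reducing L :
  homogeneous_ideal L -> is_reduction (monideal k f) L ->
  exists n (M : 'I_n -> 'I_u -> k), reducing f M /\ forall i, L (lincomb f (M i)).
Proof.
move=> [S [homS defL]] [idL LI [N /(_ N (leqnn N)) powN]].
pose T := N.-tuple 'I_u.
have tuplesN : [set monoprod k f w | w in [set w | size w = N]] =
    range (fun t : T => monoprod k f t).
  apply/seteqP; split=> [_ [w sw <-]|_ [t _ <-]].
    by exists (tcast sw (in_tuple w)); rewrite // val_tcast.
  by exists t; rewrite //= size_tuple.
have expand w : size w = N.+1 -> exists c : T -> 'I_u -> k,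
    (forall t, L (lincomb f (c t))) /\
    monoprod k f w = \sum_t lincomb f (c t) * monoprod k f t.
  move=> sw; have : ideal_mul L (ideal_pow (monideal k f) N) (monoprod k f w).
    by rewrite -powN ideal_pow_monideal; apply: sub_ideal_gen; exists w.
  have [L0 LD LM] := idL.
  pose K : set {mpoly k[d]} := [set p | exists c : T -> {mpoly k[d]},
    (forall t, L (c t)) /\ p = \sum_t c t * monoprod k f t].
  move=> mulw; have [c [Lc wE]] : K (monoprod k f w).
    apply: (ideal_gen_min _ _ mulw).
      split=> [|_ _ [c [Lc ->]] [e [Le ->]]|r _ [c [Lc ->]]].
      - by exists (fun=> 0); split=> //; rewrite big1 // => t _; rewrite mul0r.
      - exists (fun t => c t + e t); split=> [t|]; first exact: LD.
        by rewrite -big_split; apply: eq_bigr => t _; rewrite mulrDl.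
      - exists (fun t => r * c t); split=> [t|]; first exact: LM.
        by rewrite mulr_sumr; apply: eq_bigr => t _; rewrite mulrA.
    move=> _ [a La [b + <-]]; rewrite ideal_pow_monideal tuplesN.
    move=> /ideal_gen_imageP[c ->]; exists (fun t => c t * a); split=> [t|].
      exact: LM.
    by rewrite mulr_sumr; apply: eq_bigr => t _; rewrite mulrCA mulrA.
  have /choice[e eE] t := pihomog_monideal (LI _ (Lc t)).
  exists e; split=> [t|].
    by rewrite -eE; move: (Lc t); rewrite defL; apply: pihomog_ideal.
  have hw := monoprod_homog k w homf.
  rewrite -[LHS](pihomog_dE hw) {1}wE linear_sum /=; apply: eq_bigr => t _.
  have ht := monoprod_homog k t homf; rewrite size_tuple in ht.
  by rewrite sw mulnS (pihomogM _ _ ht) eE.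
have /choice[M0 M0P] (w : N.+1.-tuple 'I_u) := expand w (size_tuple w).
(* One form for each pair of a word of length [N.+1] and a word of length [N]. *)
pose P := (N.+1.-tuple 'I_u * T)%type.
exists #|{: P}|, (fun i => M0 (enum_val i).1 (enum_val i).2); split; last first.
  by move=> i; apply: (M0P _).1.
exists N => w sw; pose wt : N.+1.-tuple 'I_u := tcast sw (in_tuple w).
have -> : monoprod k f w = monoprod k f wt by rewrite /wt val_tcast.
set M := (fun i => _); rewrite (M0P wt).2.
apply: (ideal_sum_mem (K := redideal f M N)) => [|t _]; first exact: ideal_gen_ideal.
apply: sub_ideal_gen; exists (enum_rank ((wt, t) : P)) => //.
by exists t; rewrite /M ?enum_rankK //= size_tuple.
Qed.

Variable l : nat.
Hypothesis spread : is_analytic_spread (monideal k f) l.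

Lemma reduction_sub_specialized L :
  homogeneous_ideal L -> is_reduction (monideal k f) L ->
  exists la : 'M[k]_(l, u), reducing f la /\ specialized_ideal f la `<=` L.
Proof.
move=> homL redL; have [idL _ _] := redL.
have [n [M [redM LM]]] := reduction_reducing homL redL.
(* At most [l] forms are completed to [l] rows by zeros. *)
have pad m (M0 : 'I_m -> 'I_u -> k) : (m <= l)%N -> reducing f M0 ->
    (forall i, L (lincomb f (M0 i))) ->
    exists la : 'M[k]_(l, u), reducing f la /\ specialized_ideal f la `<=` L.
  move=> le_ml red0 L0; pose la : 'M[k]_(l, u) :=
    \matrix_(i, j) if insub (i : nat) : option 'I_m is Some i' then M0 i' j else 0.
  exists la; split.
    apply: reducing_sub red0 => i; apply: sub_ideal_gen.
    exists (widen_ord le_ml i) => //; apply: eq_bigr => j _.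
    by rewrite mxE /= valK.
  apply: ideal_gen_min => // _ [i _ <-].
  case E : (insub (i : nat) : option 'I_m) => [i'|].
    rewrite (eq_bigr (fun j => M0 i' j *: 'X_[f j])) => [|j _]; first exact: L0.
    by rewrite mxE E.
  rewrite big1 => [|j _]; first by case: idL.
  by rewrite mxE E scale0r.
elim: n M redM LM => [|n IHn] M redM LM; first exact: pad redM LM.
have [le_nl|lt_ln] := leqP n.+1 l; first exact: pad redM LM.
suff [e [G [homG nzG Gy]]] : exists e G,
    [/\ G \is e.-homog, G != 0 & mmap (@mpolyC d k) (fun i => lincomb f (M i)) G = 0].
  have [M' redM' subM'] := noether_step k_inf homG nzG Gy redM.
  apply: (IHn M' redM') => i; apply: (ideal_gen_min _ _ (subM' i)) => // _ [j _ <-].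
  exact: LM.
(* Without a relation the forms are algebraically independent, and the special fiber has a chain of
   primes of length [n.+1 > l]. *)
apply: contrapT => free; have [_ chain_le] := spread.
suff /chain_le : prime_chain (special_fiber (monideal k f)) n.+1.
  by rewrite leqNgt lt_ln.
apply: (@special_fiber_chain _ _ _ _ _ M delta homf) => // e G homG Gy.
by apply/eqP; apply: contrapT => /negP nzG; apply: free; exists e, G.
Qed.

End ReductionsContainGeneral.

(** * Generic linear combinations and their specializations *)

Section BaseChange.
Variables (A B : comNzRingType) (h : {rmorphism A -> B}).
Variables (d u : nat) (f : 'I_u -> 'X_{1..d}).

Lemma map_lincomb c : map_mpoly h (lincomb f c) = lincomb f (fun j => h (c j)).
Proof.
by rewrite rmorph_sum; apply: eq_bigr => j _; rewrite /= map_mpolyZ map_mpolyX.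
Qed.

Lemma map_monoprod w : map_mpoly h (monoprod A f w) = monoprod B f w.
Proof. by rewrite !monoprodE map_mpolyX. Qed.

Lemma map_redideal n (M : 'I_n -> 'I_u -> A) N p :
  redideal f M N p -> redideal f (fun i j => h (M i j)) N (map_mpoly h p).
Proof.
apply: ideal_gen_morph; first exact: ideal_gen_ideal.
move=> _ [i _ [w sw <-]]; rewrite rmorphM /= map_lincomb map_monoprod.
by apply: sub_ideal_gen; exists i => //; exists w.
Qed.

Lemma map_linideal n (M : 'I_n -> 'I_u -> A) p :
  linideal f M p -> linideal f (fun i j => h (M i j)) (map_mpoly h p).
Proof.
apply: ideal_gen_morph; first exact: ideal_gen_ideal.
by move=> _ [i _ <-]; rewrite /= map_lincomb; apply: sub_ideal_gen; exists i.
Qed.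

End BaseChange.

Lemma redideal_linideal (A : comNzRingType) d u (f : 'I_u -> 'X_{1..d}) n
    (M : 'I_n -> 'I_u -> A) N : redideal f M N `<=` linideal f M.
Proof.
apply: ideal_gen_min; first exact: ideal_gen_ideal.
move=> _ [i _ [w _ <-]]; rewrite mulrC.
have [_ _ GM] := ideal_gen_ideal (range (fun i => lincomb f (M i))).
by apply: GM; apply: sub_ideal_gen; exists i.
Qed.

Section Generic.
Variables (k : fieldType) (d u l : nat) (f : 'I_u -> 'X_{1..d}).

Local Notation A := {mpoly k[l * u]}.

Definition generic_coef (i : 'I_l) (j : 'I_u) : A := 'X_(mxvec_index i j).

Lemma generic_idealE : generic_ideal k f l = linideal f generic_coef.
Proof. by []. Qed.

Definition ev (la : 'M[k]_(l, u)) : {rmorphism A -> k} :=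
  meval (fun h => mxvec la 0 h).

Lemma ev_generic la i j : ev la (generic_coef i j) = la i j.
Proof. by rewrite /ev /= mevalXU mxvecE. Qed.

Lemma evC la c : ev la c%:MP = c.
Proof. exact: mevalC. Qed.

Lemma specialize_generic la p :
  generic_ideal k f l p -> specialized_ideal f la (map_mpoly (ev la) p).
Proof.
rewrite generic_idealE => /(map_linideal (h := ev la)).
rewrite (_ : (fun i j => _) = la) //.
by apply/funext => i; apply/funext => j; rewrite ev_generic.
Qed.

Lemma specialize_redideal (la : 'M[k]_(l, u)) N p : redideal f generic_coef N p ->
  redideal f la N (map_mpoly (ev la) p).
Proof.
move=> /(map_redideal (h := ev la)).
rewrite (_ : (fun i j => _) = la) //.
by apply/funext => i; apply/funext => j; rewrite ev_generic.
Qed.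

Lemma specialized_ideal_lift la p : specialized_ideal f la p ->
  exists2 q, generic_ideal k f l q & map_mpoly (ev la) q = p.
Proof.
move=> lap; suff : (map_mpoly (ev la) @` generic_ideal k f l) p by case=> q; exists q.
apply: (ideal_gen_min _ _ lap).
  apply: image_ideal; first exact: ideal_gen_ideal.
  move=> q; exists (map_mpoly (@mpolyC _ k) q); apply/mpolyP => m.
  by rewrite !mcoeff_map_mpoly; exact: evC.
move=> _ [i _ <-]; exists (lincomb f (generic_coef i)).
  by apply: sub_ideal_gen; exists i.
by rewrite map_lincomb; apply: eq_bigr => j _; rewrite ev_generic.
Qed.

Variable delta : nat.
Hypothesis homf : forall j, mdeg (f j) = delta.

(* If [la] is reducing, the matrix expressing the products of [N+1]
   generators through themselves by means of the generic combinations is the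
   identity at [la]; its determinant is the required [g]. *)
Lemma reducing_generic (la : 'M[k]_(l, u)) : reducing f la ->
  exists2 g, ev la g != 0 &
    exists N, forall w, size w = N.+1 ->
      redideal f generic_coef N (g *: monoprod A f w).
Proof.
move=> [N HN]; pose T := ('I_l * N.-tuple 'I_u)%type.
pose W := N.+1.-tuple 'I_u.
have redT : [set lincomb f (la i) * monoprod k f w | i in setT & w in [set w | size w = N]] =
    range (fun q : T => lincomb f (la q.1) * monoprod k f q.2).
  apply/seteqP; split=> [_ [i _ [w sw <-]]|_ [q _ <-]].
    by exists (i, tcast sw (in_tuple w)); rewrite //= val_tcast.
  by exists q.1 => //; exists q.2; rewrite //= size_tuple.
have /choice[c cE] (w : W) : exists c : T -> k, monoprod k f w =
    \sum_q c q *: (lincomb f (la q.1) * monoprod k f q.2).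
  have := HN w (size_tuple w); rewrite /redideal redT => /ideal_gen_imageP[c wE].
  (* All products involved have degree [delta * N.+1], so constant terms suffice as coefficients. *)
  exists (fun q => (c q)@_0%MM); have hw := monoprod_homog k w homf.
  rewrite -[LHS](pihomog_dE hw) wE linear_sum /=; apply: eq_bigr => q _.
  have hq : lincomb f (la q.1) * monoprod k f q.2 \is (delta * N.+1).-homog.
    rewrite mulnS; apply: dhomogM; first exact: lincomb_homog.
    by have := monoprod_homog k q.2 homf; rewrite size_tuple.
  by rewrite size_tuple -[X in pihomog _ X](add0n) (pihomogM _ _ hq) pihomog0E mul_mpolyC.
(* [s] vanishes at [la]; adding it to the identity matrix turns each [la i j] in the relations [cE]
   into the variable z_ij. *)
pose s (w : W) (q : T) j : A := c w q *: (generic_coef q.1 j - (la q.1 j)%:MP).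
pose D : 'M[A]_#|{: W}| := \matrix_(a, b) ((a == b)%:R +
  \sum_(q : T) \sum_j if enum_val b == cons_tuple j q.2 then s (enum_val a) q j else 0).
exists (\det D).
  rewrite -det_map_mx (_ : map_mx _ D = 1%:M) ?det1 ?oner_eq0 //.
  apply/matrixP => a b; rewrite !mxE rmorphD rmorph_nat rmorph_sum big1 ?addr0 //.
  move=> q _; rewrite rmorph_sum big1 // => j _; case: ifP => _; last exact: rmorph0.
  by rewrite /s -mul_mpolyC rmorphM rmorphB /= ev_generic !evC subrr mulr0.
exists N; suff key (a : 'I_#|{: W}|) :
    redideal f generic_coef N (\det D *: monoprod A f (enum_val a)).
  move=> w sw; have := key (enum_rank (tcast sw (in_tuple w))).
  by rewrite enum_rankK val_tcast.
pose e (a : 'I_#|{: W}|) := monoprod A f (enum_val a : W).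
rewrite -[monoprod _ _ _]/(e a) -mul_mpolyC -det_map_mx; apply: adjugate_ideal.
  exact: ideal_gen_ideal.
move=> {}a; set v := enum_val a.
have [_ _ GM] := @ideal_gen_ideal {mpoly A[d]}
  [set lincomb f (generic_coef i) * monoprod A f w | i in setT & w in [set w | size w = N]].
suff -> : \sum_b (map_mx (@mpolyC d A) D) a b * e b =
    \sum_q (c v q)%:MP%:MP * (lincomb f (generic_coef q.1) * monoprod A f q.2).
  apply: ideal_sum_mem => [|q _]; first exact: ideal_gen_ideal.
  by apply: (GM); apply: sub_ideal_gen; exists q.1 => //; exists q.2; rewrite //= size_tuple.
have vE : e a = \sum_q (c v q)%:MP *:
    (lincomb f (fun j => (la q.1 j)%:MP) * monoprod A f q.2).
  rewrite /e -(map_monoprod (@mpolyC (l * u) k)) -/v cE rmorph_sum.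
  apply: eq_bigr => q _; rewrite /= map_mpolyZ rmorphM /= map_lincomb map_monoprod.
  by [].
have DE b : (map_mx (@mpolyC d A) D) a b * e b = (if b == a then e a else 0) +
    \sum_q \sum_j (if enum_val b == cons_tuple j q.2 then
      s v q j *: ('X_[f j] * monoprod A f q.2) else 0).
  rewrite !mxE mul_mpolyC scalerDl scaler_suml; congr (_ + _).
    by rewrite eq_sym; case: eqP => [->|_]; rewrite ?scale1r ?scale0r.
  apply: eq_bigr => q _; rewrite scaler_suml; apply: eq_bigr => j _.
  case: eqP => [bE|_]; last by rewrite scale0r.
  by rewrite /e bE monoprod_cons.
under eq_bigr => b _ do rewrite DE.
rewrite big_split /= -big_mkcond big_pred1_eq vE exchange_big -big_split /=.
apply: eq_bigr => q _; rewrite exchange_big /=.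
rewrite (eq_bigr (fun j => s v q j *: ('X_[f j] * monoprod A f q.2))); last first.
  move=> j _; rewrite -big_mkcond (big_pred1 (enum_rank (cons_tuple j q.2 : W))) //.
  by move=> b /=; rewrite -[in RHS](enum_valK b) (inj_eq enum_rank_inj).
rewrite mul_mpolyC /lincomb !mulr_suml !scaler_sumr -big_split; apply: eq_bigr => j _.
rewrite /= /s -!scalerAl !scalerA -scalerDl; congr (_ *: _).
by rewrite -mul_mpolyC mulrBr addrC subrK.
Qed.

End Generic.

(** * Monomials in the generic ideal and in its specializations *)

Section Saturation.
Variables (k : fieldType) (d u l delta : nat) (f : 'I_u -> 'X_{1..d}).
Hypothesis homf : forall j, mdeg (f j) = delta.

Local Notation A := {mpoly k[l * u]}.
Local Notation J := (generic_ideal k f l).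

Let lift : {rmorphism {mpoly k[d]} -> {mpoly A[d]}} := map_mpoly (@mpolyC (l * u) k).

Let evK (la : 'M[k]_(l, u)) p : map_mpoly (ev la) (lift p) = p.
Proof. by apply/mpolyP => m; rewrite !mcoeff_map_mpoly; exact: evC. Qed.

Lemma generic_ideal_pihomog e p : J p -> J (pihomog mdeg e p).
Proof.
apply: pihomog_ideal => _ [i _ <-]; exists delta.
exact: (@lincomb_homog A d u f delta (generic_coef k i) homf).
Qed.

(** One [h] serves all [n]: away from its zeros, division by x^s and by x^c in the specialized ideal
    lifts to the saturation of J, whatever power of x^s occurs. *)
Lemma generic_saturation (c s : 'X_{1..d}) : exists h : A, h != 0 /\
  forall (la : 'M[k]_(l, u)) n, ev la h != 0 ->
    specialized_ideal f la 'X_[c + s *+ n] ->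
  exists (a : A) n', a != 0 /\ J (a *: 'X_[c + s *+ n']).
Proof.
(* [L] is the saturation of [J] by [x^s], so that [L : x^s = L]. *)
pose L : set {mpoly A[d]} := [set p | exists n, J ('X_[s *+ n] * p)].
have [J0 JD JM] : is_ideal J by exact: ideal_gen_ideal.
have idL : is_ideal L.
  split=> [|p q [n Jp] [m Jq]|r p [n Jp]].
  - by exists 0%N; rewrite mulr0.
  - exists (m + n)%N; rewrite -mpolyXn exprD !mpolyXn mulrDr -mulrA.
    by apply: JD; [|rewrite mulrAC mulrC]; apply: JM.
  - by exists n; rewrite mulrCA; apply: JM.
have [a1 nza1 colon1] := generic_colon 'X_[s] idL.
have [a2 nza2 colon2] := generic_colon 'X_[c] idL.
exists (a1 * a2); split; first by rewrite mulf_neq0.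
move=> la n; rewrite rmorphM mulf_eq0 negb_or => /andP[eva1 eva2] lac.
have surj x : exists y, ev la y = x by exists x%:MP; exact: evC.
(* Factors x^s are cancelled one at a time inside the image of [L], as [L] is saturated. *)
have sat m p : (exists2 q, L q & map_mpoly (ev la) q = 'X_[s *+ m] * p) ->
    exists2 q, L q & map_mpoly (ev la) q = p.
  elim: m p => [|m IHm] p [q Lq qE].
    by exists q; rewrite // qE mulm0n mpolyX0 mul1r.
  apply: IHm; have [|p' [n' Jp'] p'E] :=
      colon1 _ (ev la) surj eva1 (lift ('X_[s *+ m] * p)) q Lq.
    by rewrite rmorphM /= evK map_mpolyX qE mulmS mpolyXD mulrA.
  exists p'; last by rewrite p'E evK.
  by exists n'.+1; rewrite mulmSr mpolyXD -mulrA ['X_[s] * _]mulrC.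
have [q Jq qE] := specialized_ideal_lift lac.
have [|q1 Lq1 q1E] := sat n 'X_[c].
  exists q; last by rewrite qE mpolyXD mulrC.
  by exists 0%N; rewrite mulm0n mpolyX0 mul1r.
have [|p [n' Jp] pE] := colon2 _ (ev la) surj eva2 1 q1 Lq1.
  by rewrite mulr1 q1E map_mpolyX.
(* [p] specializes to 1, so its constant term is nonzero; taking the component in the degree of the
   monomial isolates that term. *)
exists (p@_0%MM), n'; split.
  have : ev la p@_0%MM = 1 by rewrite -mcoeff_map_mpoly pE rmorph1 mcoeff1 eqxx.
  by apply: contra_eq_neq => ->; rewrite rmorph0 eq_sym oner_neq0.
move: Jp; rewrite mulrC -mulrA -mpolyXD.
have hX : 'X_[A, c + s *+ n'] \is (mdeg (c + s *+ n')).-homog by rewrite dhomogX.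
move=> /(generic_ideal_pihomog (0 + mdeg (c + s *+ n'))).
by rewrite (pihomogM _ _ hX) pihomog0E mul_mpolyC.
Qed.

Section Coefficients.
Variables (r : nat) (v : 'I_r -> 'X_{1..d}) (C : 'I_r -> set A).

(** Shows which [C i] can contribute to a coefficient. If no [v i] is below [w] the family is empty
    and the coefficient is zero. *)
Lemma coef_monomial_sum p :
  ideal_sum (fun i => coef_monomial_ideal (C i) (v i)) p ->
  forall w, ideal_gen (\bigcup_(i in [set i | (v i <= w)%MM]) C i) p@_w.
Proof.
pose K : set {mpoly A[d]} :=
  [set p | forall w, ideal_gen (\bigcup_(i in [set i | (v i <= w)%MM]) C i) p@_w].
have GI w : is_ideal (ideal_gen (\bigcup_(i in [set i | (v i <= w)%MM]) C i)).
  exact: ideal_gen_ideal.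
have idK : is_ideal K.
  rewrite /K; split=> /= [w|a b Ka Kb w|q a Ka w]; have [G0 GD GM] := GI w.
  - by rewrite mcoeff0.
  - by rewrite mcoeffD; apply: GD.
  - rewrite mcoeffM; apply: ideal_sum_mem => // x /eqP wE; apply: GM.
    apply: ideal_gen_mono (Ka x.2) => b [i /= le_i Cb]; exists i => //=.
    by apply: lepm_trans le_i _; have := lem_addl x.1 x.2; rewrite -wE.
move=> Sp; suff : K p by []; apply: (ideal_gen_min idK _ Sp) => {Sp}p [i _ Cp].
apply: (ideal_gen_min idK _ Cp) => _ [c Cc <-] w; have [G0 _ _] := GI w.
rewrite mcoeffZ mcoeffX; case: eqP => [<-|_]; last by rewrite mulr0.
rewrite mulr1; apply: sub_ideal_gen; exists i => //=; exact: lepm_refl.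
Qed.

End Coefficients.

End Saturation.

(** * The graded core *)

Section TorusAction.
Variables (k : fieldType) (d u : nat) (f : 'I_u -> 'X_{1..d}).
Variable t : 'I_d -> k.
Hypothesis nzt : forall i, t i != 0.

Lemma mmap1_neq0 m : mmap1 t m != 0.
Proof. by apply/prodf_neq0 => i _; rewrite expf_neq0. Qed.

Lemma torus_lincomb c : torus t (lincomb f c) = lincomb f (fun j => mmap1 t (f j) * c j).
Proof.
rewrite rmorph_sum; apply: eq_bigr => j _.
by rewrite /= torusZ torusX scalerA mulrC.
Qed.

Lemma torus_reducing n (M : 'I_n -> 'I_u -> k) :
  reducing f M -> reducing f (fun i j => mmap1 t (f j) * M i j).
Proof.
move=> [N HN]; exists N => w sw; set M' := fun i j => _.
have redI : is_ideal (redideal f M' N) by exact: ideal_gen_ideal.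
have : redideal f M' N (torus t (monoprod k f w)).
  apply: (ideal_gen_morph (phi := torus t) redI _ (HN w sw)).
  move=> _ [i _ [w' sw' <-]]; rewrite rmorphM /= torus_lincomb [monoprod _ _ _]monoprodE.
  rewrite torusX -scalerAr; apply: (ideal_scale (L := redideal f M' N)) => //.
  apply: sub_ideal_gen.
  by exists i => //; exists w'; rewrite // monoprodE.
rewrite monoprodE torusX => /(ideal_scale (mmap1 t (\sum_(j <- w) f j))^-1 redI).
by rewrite scalerA mulVf ?mmap1_neq0 ?scale1r.
Qed.

Lemma torus_specialized l (la : 'M[k]_(l, u)) p : specialized_ideal f la p ->
  specialized_ideal f (\matrix_(i, j) (mmap1 t (f j) * la i j)) (torus t p).
Proof.
apply: ideal_gen_morph; first exact: ideal_gen_ideal.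
move=> _ [i _ <-]; apply: sub_ideal_gen; exists i => //.
rewrite [RHS](@torus_lincomb (la i)); apply: eq_bigr => j _.
by rewrite mxE.
Qed.

End TorusAction.

Section GradedCore.
Variables (k : fieldType) (d u delta l : nat) (f : 'I_u -> 'X_{1..d}).
Hypothesis k_inf : infinite_set [set: k].
Hypothesis homf : forall j, mdeg (f j) = delta.
Hypothesis spread : is_analytic_spread (monideal k f) l.

Lemma graded_coreE : graded_core (monideal k f) =
  [set p | forall la : 'M[k]_(l, u), reducing f la -> specialized_ideal f la p].
Proof.
apply/seteqP; split=> [p core_p la red_la|p core_p L [redL homL]].
  apply: core_p; split; first exact: reducing_reduction red_la.
  exists (range (fun i => lincomb f (la i))); split=> // _ [i _ <-].
  by exists delta; apply: lincomb_homog.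
have [la [red_la sub_la]] := reduction_sub_specialized k_inf homf spread homL redL.
by apply: sub_la; apply: core_p.
Qed.

Lemma exists_reducing : exists la : 'M[k]_(l, u), reducing f la.
Proof.
have homI := homogeneous_monideal k homf.
have redI : is_reduction (monideal k f) (monideal k f).
  split=> //; first exact: ideal_gen_ideal.
  by exists 0%N.
by have [la [red_la _]] := reduction_sub_specialized k_inf homf spread homI redI; exists la.
Qed.

Lemma graded_core_monomial p m : graded_core (monideal k f) p ->
  m \in msupp p -> graded_core (monideal k f) 'X_[m].
Proof.
rewrite graded_coreE; apply: torus_stable_monomial => //.
- move=> {}p q core_p core_q la red_la; have [_ GD _] :=
    ideal_gen_ideal (range (fun i => lincomb f (la i))).
  by apply: GD; [exact: core_p | exact: core_q].
- move=> c {}p core_p la red_la; apply: (ideal_scale (L := specialized_ideal f la)).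
    exact: ideal_gen_ideal.
  exact: core_p.
(* The inverse torus element carries [la] to another reducing point [la']. Its ideal contains [p],
   so the ideal of [la] contains the translate of [p]. *)
move=> t {}p nzt core_p la red_la; pose t' i := (t i)^-1.
have nzt' i : t' i != 0 by rewrite invr_eq0.
pose la' : 'M[k]_(l, u) := \matrix_(i, j) (mmap1 t' (f j) * la i j).
have -> : la = \matrix_(i, j) (mmap1 t (f j) * la' i j).
  apply/matrixP => i j; rewrite !mxE mulrA /mmap1 -big_split big1 ?mul1r // => a _.
  by rewrite /= -exprMn mulfV // expr1n.
apply: torus_specialized; apply: core_p.
have : reducing f (fun i j => mmap1 t' (f j) * la i j) by exact: torus_reducing.
apply: reducing_sub => i; apply: sub_ideal_gen; exists i => //.
by apply: eq_bigr => j _; rewrite mxE.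
Qed.

Lemma graded_core_sub_mono (la : 'M[k]_(l, u)) : reducing f la ->
  graded_core (monideal k f) `<=` mono (specialized_ideal f la).
Proof.
move=> red_la p core_p; rewrite [p]mpolyE big_seq.
apply: ideal_sum_mem => [|m mp]; first exact: ideal_gen_ideal.
apply: (ideal_scale (L := mono _)); first exact: ideal_gen_ideal.
have := graded_core_monomial core_p mp; rewrite graded_coreE => /(_ la red_la) la_m.
apply: sub_ideal_gen; exists (ideal_gen [set 'X_[m'] | m' in [set m]]); last first.
  by apply: sub_ideal_gen; exists m.
split; first by exists [set m].
by apply: ideal_gen_min => [|_ [_ -> <-]] //; exact: ideal_gen_ideal.
Qed.

Lemma mono_sub_graded_core (la : 'M[k]_(l, u)) :
  (forall m, specialized_ideal f la 'X_[m] -> graded_core (monideal k f) 'X_[m]) ->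
  mono (specialized_ideal f la) `<=` graded_core (monideal k f).
Proof.
move=> mon_la.
have core_ideal : is_ideal (graded_core (monideal k f)).
  split=> [L [[[L0 _ _] _ _] _] //|a b core_a core_b L redL|r a core_a L redL].
  - by case: (redL) => -[[_ LD _] _ _] _; apply: LD; [exact: core_a|exact: core_b].
  - by case: (redL) => -[[_ _ LM] _ _] _; apply: LM; exact: core_a.
apply: ideal_gen_min => // p [M [[S ->] ML] Mp]; apply: (ideal_gen_min _ _ Mp) => //.
by move=> _ [m Sm <-]; apply: mon_la; apply: ML; apply: sub_ideal_gen; exists m.
Qed.

End GradedCore.

Theorem theorem5p10 (k : fieldType) (d u delta : nat)
    (f : 'I_u -> 'X_{1..d}) (I : set {mpoly k[d]}) (l r : nat)
    (v : 'I_r -> 'X_{1..d}) (C : 'I_r -> set {mpoly k[l * u]}) :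
  infinite_set [set: k] ->
  (forall j, mdeg (f j) = delta) ->
  I = generated_by_monomials k f ->
  I <> [set 0] ->
  is_analytic_spread I l ->
  injective v ->
  (forall i, is_ideal (C i)) ->
  mono_param (generic_ideal k f l) =
    ideal_sum (fun i => coef_monomial_ideal (C i) (v i)) ->
  (forall i, radical (C i) = ideal_sum C) ->
  for_general
    [set la : 'M[k]_(l, u) | graded_core I = mono (specialized_ideal f la)].
Proof.
move=> k_inf homf -> nzI spread _ idC monoJ radC.
(* A generator exists since [I] is nonzero; repeating it gives words of any length. *)
have [j0 _] : exists j0 : 'I_u, true.
  apply: contrapT => no_j; apply: nzI; apply/seteqP; split=> [|_ ->]; last first.
    by case: (ideal_gen_ideal (range (fun j => 'X_[k, f j]))).
  apply: ideal_gen_min => [|_ [j _ <-]]; last by case: no_j; exists j.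
  split=> [|x y -> ->|a x ->] //=; [exact: addr0 | exact: mulr0].
have monoJP a m : generic_ideal k f l (a *: 'X_[m]) -> forall w,
    ideal_gen (\bigcup_(i in [set i | (v i <= w)%MM]) C i) (a *: 'X_[m])@_w.
  move=> Jam; apply: coef_monomial_sum; rewrite -monoJ.
  by apply: sub_ideal_gen; split=> //; exists a, m.
have coefJ a m : a != 0 -> generic_ideal k f l (a *: 'X_[m]) ->
    exists i, (v i <= m)%MM.
  move=> nza /monoJP/(_ m); rewrite mcoeffZ mcoeffX eqxx mulr1 => Ca.
  apply: contrapT => no_i; case/eqP: nza.
  have id0 : is_ideal [set 0 : {mpoly k[l * u]}].
    by split=> [|x y -> ->|s x ->] //=; [exact: addr0 | exact: mulr0].
  by apply: (ideal_gen_min id0 _ Ca) => b [i /= le_i _]; case: no_i; exists i.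
have vanishing (mu : 'M[k]_(l, u)) i : reducing f mu ->
    specialized_ideal f mu 'X_[v i].
  move=> red_mu; have [g nzg [N HN]] := reducing_generic homf red_mu.
  have Cg : ideal_sum C g.
    have := HN (nseq N.+1 j0); rewrite size_nseq => /(_ erefl)/redideal_linideal.
    rewrite monoprodE => /monoJP/(_ (\sum_(j <- nseq N.+1 j0) f j)%MM).
    rewrite mcoeffZ mcoeffX eqxx mulr1; apply: ideal_gen_mono => b [j _ Cb].
    by exists j.
  (* The radical hypothesis puts a power of [g] in [C i]; its value at [mu] is invertible. *)
  move: Cg; rewrite -(radC i) => -[n Cgn].
  have : generic_ideal k f l (g ^+ n *: 'X_[v i]).
    suff : mono_param (generic_ideal k f l) (g ^+ n *: 'X_[v i]).
      by apply: ideal_gen_min => [|p []//]; exact: ideal_gen_ideal.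
    rewrite monoJ; apply: sub_ideal_gen; exists i => //.
    by apply: sub_ideal_gen; exists (g ^+ n).
  move=> /(specialize_generic (la := mu)); rewrite map_mpolyZ map_mpolyX rmorphXn.
  move=> /(ideal_scale (ev mu g ^- n) (ideal_gen_ideal _)).
  by rewrite scalerA mulVf ?expf_neq0 // scale1r.
have [la0 red0] := exists_reducing k_inf homf spread.
have [g nzg [N HN]] := reducing_generic homf red0.
(* Membership of a monomial in the ideal of the x^(v i) is unchanged when its
   exponents are cut off at [D]. *)
pose D := \max_(i < r) mdeg (v i).
pose cut (e : {ffun 'I_d -> 'I_D.+1}) : 'X_{1..d} := [multinom (e x : nat) | x < d].
pose full (e : {ffun 'I_d -> 'I_D.+1}) : 'X_{1..d} :=
  [multinom nat_of_bool (D <= e x)%N | x < d].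
have /choice[h hP] e := @generic_saturation k d u l delta f homf (cut e) (full e).
(* [g] keeps the point reducing; the factors [h e] control the finitely many cut-off exponents. *)
pose H := g * \prod_e h e.
have nzH : H != 0.
  rewrite mulf_neq0 //; last by apply/prodf_neq0 => e _; have [] := hP e.
  by apply: contraNneq nzg => ->; rewrite rmorph0.
exists [set la | eval_at la H != 0]; split.
- by exists [set H]; apply/seteqP; split=> [la|la [_ -> //]]; exists H.
- move=> _ [S ->] [la [g' Sg' nzg']].
  have nzHg' : H * g' != 0.
    by rewrite mulf_neq0 //; apply: contraNneq nzg' => ->; rewrite /eval_at meval0.
  have [x] := mpoly_nonvanishing k_inf nzHg'.
  rewrite mevalM mulf_eq0 negb_or => /andP[Hx g'x].
  pose lx : 'M[k]_(l, u) := vec_mx (\row_h x h).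
  have evx p : eval_at lx p = p.@[x].
    by apply: meval_eq => i; rewrite vec_mxK mxE.
  by exists lx; split=> /=; [|exists g' => //]; rewrite evx.
move=> la /=; rewrite -[eval_at la H]/(ev la H) rmorphM mulf_eq0 negb_or.
move=> /andP[nzg_la nzh_la].
have red_la : reducing f la.
  exists N => w sw; have := specialize_redideal (la := la) (HN w sw).
  rewrite map_mpolyZ map_monoprod.
  move=> /(ideal_scale (ev la g)^-1 (ideal_gen_ideal _)).
  by rewrite scalerA mulVf // scale1r.
apply/seteqP; split; first exact: graded_core_sub_mono red_la.
apply: mono_sub_graded_core => m la_m.
rewrite (graded_coreE k_inf homf spread) => mu red_mu.
pose e : {ffun 'I_d -> 'I_D.+1} := [ffun x => inord (minn (m x) D)].
have eE x : e x = minn (m x) D :> nat by rewrite ffunE inordK // ltnS geq_minr.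
have le_mdeg (q : 'X_{1..d}) x : (q x <= mdeg q)%N.
  by rewrite mdegE (bigD1 x) //= leq_addr.
(* Where [m] is cut off at [D], [mdeg m] copies of [full e] make up the difference. *)
have le_m : (m <= cut e + full e *+ mdeg m)%MM.
  apply/mnm_lepP => x; rewrite mnmDE mulmnE !mnmE eE.
  have [le_mD|lt_Dm] := leqP (m x) D; first exact: leq_addr.
  by rewrite leqnn mul1n (leq_trans (le_mdeg m x)) ?leq_addl.
have dvd_mem (nu : 'M[k]_(l, u)) (p q : 'X_{1..d}) : (p <= q)%MM ->
    specialized_ideal f nu 'X_[p] -> specialized_ideal f nu 'X_[q].
  move=> /submK <-; rewrite mpolyXD.
  by have [_ _ GM] := ideal_gen_ideal (range (fun i => lincomb f (nu i))); apply: GM.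
have nzh_e : ev la (h e) != 0.
  by move: nzh_la; rewrite rmorph_prod => /prodf_neq0/(_ e isT).
have [a [n [nza Ja]]] := (hP e).2 la (mdeg m) nzh_e (dvd_mem _ _ _ le_m la_m).
have [i /mnm_lepP le_vi] := coefJ _ _ nza Ja.
apply: dvd_mem (vanishing mu i red_mu); apply/mnm_lepP => x.
have := le_vi x; rewrite mnmDE mulmnE !mnmE eE.
(* Below [D] the vector [full e] vanishes and [m] itself bounds [v i]; otherwise [D] bounds [v i]
   and [m] is at least [D]. *)
have [lt_mD|le_Dm] := ltnP (m x) D.
  by rewrite [(D <= _)%N]leqNgt lt_mD mul0n addn0.
move=> _; apply: leq_trans le_Dm; apply: leq_trans (le_mdeg _ _) _.
exact: (leq_bigmax_cond (F := fun i => mdeg (v i))).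
Qed.
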